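(* Let $r\geq 3$, $\ell\geq 4$, $k_1\geq 2$ and $k_2\geq 0$ be integers. Then for all sufficiently large $n$ (in terms of $r,\ell,k_1,k_2$), $$\mathrm{ex}_r(n,k_1P_\ell^r\cup k_2S_\ell^r)\leq \binom{n}{r}-\binom{n-k_2}{r}+\mathrm{ex}_r(n-k_2,k_1P_\ell^r)$$ and $$\mathrm{ex}_r(n,k_1P_\ell^r\cup k_2S_\ell^r)\geq \binom{n}{r}-\binom{n-k_1-k_2+1}{r}+\mathrm{ex}_r(n-k_1-k_2+1,\{P_\ell^r,S_\ell^r\}).$$
   Context: An $r$-graph ($r$-uniform hypergraph) $H=(V(H),E(H))$ is a finite vertex set together with a set of $r$-element subsets of it (edges). The $r$-uniform linear path $P_\ell^r$ of length $\ell$ is the $r$-graph with edges $e_1,\dots,e_\ell$ such that $|e_i\cap e_j|=1$ if $|i-j|=1$ and $e_i\cap e_j=\emptyset$ for all other $i\neq j$ (with no vertices outside these edges). The $r$-uniform linear star $S_\ell^r$ is the $r$-graph with $\ell$ edges obtained from the graph star with $\ell$ edges by inserting $r-2$ new distinct vertices in each edge (so all $\ell$ edges share one common vertex and are otherwise pairwise disjoint). $H\cup G$ denotes disjoint union and $kH$ the disjoint union of $k$ copies of $H$. For a family $\mathcal{F}$ of $r$-graphs, an $r$-graph is $\mathcal{F}$-free if it contains no member of $\mathcal{F}$ as a (not necessarily induced) subgraph; the Turán number $\mathrm{ex}_r(n,\mathcal{F})$ is the maximum number of edges in an $\mathcal{F}$-free $r$-graph on $n$ vertices, and $\mathrm{ex}_r(n,F)=\mathrm{ex}_r(n,\{F\})$.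 Host hypergraphs here are not required to be linear. *)

(* Defs.v *)
From mathcomp Require Import all_boot.

Set Implicit Arguments.
Unset Strict Implicit.
Unset Printing Implicit Defensive.

(** Finite hypergraphs; an r-graph is a hypergraph [H] with [uniform r H]. *)
Record hypergraph := Hypergraph {
  vertex : finType;
  edges : {set {set vertex}}
}.

Definition uniform (r : nat) (H : hypergraph) : bool :=
  [forall e in edges H, #|e| == r].

(** [F] is a (not necessarily induced) subgraph of [H], up to isomorphism. *)
Definition contains (H F : hypergraph) : bool :=
  [exists f : {ffun vertex F -> vertex H},
     injectiveb f && [forall e in edges F, f @: e \in edges H]].

Definition free (Fs : seq hypergraph) (H : hypergraph) : bool :=
  all (fun F => ~~ contains H F) Fs.

(** The vertex set is taken to be ['I_n], without loss of generality since
    [free] and [uniform] are invariant under relabelling the vertices. *)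
Definition turan (r n : nat) (Fs : seq hypergraph) : nat :=
  \max_(E : {set {set 'I_n}} |
          uniform r (Hypergraph E) && free Fs (Hypergraph E)) #|E|.

Definition disjoint_union (H G : hypergraph) : hypergraph :=
  @Hypergraph (vertex H + vertex G)%type
    ([set [set inl v | v in (e : {set vertex H})] | e in edges H] :|:
     [set [set inr v | v in (e : {set vertex G})] | e in edges G]).

Definition copies (k : nat) (H : hypergraph) : hypergraph :=
  @Hypergraph ('I_k * vertex H)%type
    (\bigcup_(i < k)
       [set [set (i, v) | v in (e : {set vertex H})] | e in edges H]).

(** The i-th edge (i < l) of the linear path is the block of r consecutive
    vertices i(r-1), ..., (i+1)(r-1) of {0, ..., l(r-1)}. *)
Definition path_edge (r l : nat) (i : 'I_l) : {set 'I_(l * r.-1).+1} :=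
  [set v : 'I_(l * r.-1).+1 | i * r.-1 <= v <= i.+1 * r.-1].

Definition linear_path (r l : nat) : hypergraph :=
  @Hypergraph 'I_(l * r.-1).+1 [set path_edge r i | i : 'I_l].

(** [inl None] is the centre and [inl (Some i)] the i-th leaf of the graph
    star; [inr (i, j)] is the j-th vertex inserted in its i-th edge. *)
Definition star_edge (r l : nat) (i : 'I_l) :
    {set option 'I_l + 'I_l * 'I_(r - 2)} :=
  [set inl None; inl (Some i)] :|: [set inr (i, j) | j : 'I_(r - 2)].

Definition linear_star (r l : nat) : hypergraph :=
  @Hypergraph (option 'I_l + 'I_l * 'I_(r - 2))%type
    [set star_edge r i | i : 'I_l].

(** The lemmas below confirm that these concrete hypergraphs have the properties
    defining the linear path and star for r >= 2; the statement does not use them. *)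

Lemma card_path_edge (r l : nat) (i : 'I_l) : 0 < r -> #|path_edge r i| = r.
Proof.
case: r => // s _; rewrite /path_edge /=.
have lt_v (j : 'I_s.+1) : i * s + j < (l * s).+1.
  rewrite ltnS (@leq_trans (i.+1 * s)) //; last by rewrite leq_mul2r ltn_ord orbT.
  by rewrite mulSn addnC leq_add2r -ltnS.
rewrite -[RHS](card_ord s.+1) -(@card_imset _ _ (fun j => Ordinal (lt_v j))).
  apply: eq_card => v; rewrite inE; apply/andP/imsetP => [[le_v ge_v]|[j _ ->]].
    have lt_j : v - i * s < s.+1 by rewrite ltnS leq_subLR addnC -mulSn.
    by exists (Ordinal lt_j) => //; apply: val_inj; rewrite /= subnKC.
  by rewrite /= leq_addr mulSn addnC leq_add2r -ltnS.
by move=> j k [] /eqP; rewrite eqn_add2l => /eqP /val_inj.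
Qed.

Lemma uniform_linear_path (r l : nat) : 0 < r -> uniform r (linear_path r l).
Proof.
move=> r_gt0; apply/forall_inP => e /imsetP[i _ ->].
by rewrite card_path_edge.
Qed.

Lemma path_edge_succ (r l : nat) (i j : 'I_l) :
  1 < r -> j = i.+1 :> nat -> #|path_edge r i :&: path_edge r j| = 1.
Proof.
case: r => [|[|s]] // _ ij.
have lt_v : j * s.+1 < (l * s.+1).+1 by rewrite ltnS leq_mul2r ltnW.
apply/eqP/cards1P; exists (Ordinal lt_v); apply/setP => v.
rewrite !inE /= -val_eqE /= -ij eqn_leq.
apply/idP/idP => [/andP[/andP[_ ->] /andP[-> _]] //|/andP[le1 le2]].
rewrite le1 le2 /= (leq_trans _ le2) ?leq_mul2r ?ij ?leqnSn ?orbT //=.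
by rewrite (leq_trans le1) // leq_mul2r ij leqnSn orbT.
Qed.

Lemma path_edge_disjoint (r l : nat) (i j : 'I_l) :
  1 < r -> i.+1 < j -> path_edge r i :&: path_edge r j = set0.
Proof.
case: r => [|[|s]] // _ ij; apply/setP => v; rewrite !inE /=.
apply/negP => /andP[/andP[_ le1] /andP[le2 _]].
by have := leq_trans le2 le1; rewrite leq_mul2r /= leqNgt ij.
Qed.

Lemma path_edge_cover (r l : nat) :
  0 < l -> 1 < r -> \bigcup_(i < l) path_edge r i = setT.
Proof.
case: l => // l _; case: r => [|[|s]] // _; apply/setP => v; rewrite [RHS]inE.
apply/bigcupP; have := ltn_ord v; rewrite ltnS leq_eqVlt => /orP[/eqP v_max|v_lt].
  by exists ord_max => //; rewrite inE /= v_max leqnn leq_mul2r leqnSn orbT.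
have lt_i : v %/ s.+1 < l.+1 by rewrite ltn_divLR.
by exists (Ordinal lt_i) => //; rewrite inE /= leq_divM ltnW // ltn_ceil.
Qed.

Lemma card_star_edge (r l : nat) (i : 'I_l) : 1 < r -> #|star_edge r i| = r.
Proof.
move=> r_gt1; rewrite /star_edge cardsU (_ : _ :&: _ = set0).
  rewrite cards0 subn0 cards2 card_imset ?card_ord; last by move=> j k [].
  by rewrite subnKC.
apply/setP => v; rewrite !inE; apply/negP => /andP[/orP[]/eqP-> /imsetP[]] //.
Qed.

Lemma uniform_linear_star (r l : nat) : 1 < r -> uniform r (linear_star r l).
Proof.
move=> r_gt1; apply/forall_inP => e /imsetP[i _ ->].
by rewrite card_star_edge.
Qed.

Lemma star_edgeI (r l : nat) (i j : 'I_l) :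
  i != j -> star_edge r i :&: star_edge r j = [set inl None].
Proof.
move=> neq_ij; apply/setP => v; rewrite !inE.
apply/idP/eqP => [/andP[]|->]; last by rewrite eqxx.
case/orP=> [/orP[/eqP->|/eqP->]|/imsetP[a _ ->]] //=.
  case/orP=> [/eqP[ij]|/imsetP[] //]; by rewrite ij eqxx in neq_ij.
by case/imsetP=> b _ [ij]; rewrite ij eqxx in neq_ij.
Qed.

(* Main.v *)
Require Import Defs.
From mathcomp Require Import all_boot zify.

(** Lower bound. Let T have k1 + k2 - 1 vertices. Take all r-sets that meet T,
    together with an extremal hypergraph, free of the path and of the star, on
    the remaining vertices. The forbidden hypergraph has k1 + k2 components, so
    one of them would avoid T and lie in the second part
    ([hitting_relabel_free]). The same construction with 2 * k1 - 1 vertices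
    bounds the Turan number of k1 paths from below, because every copy of the
    path contains two disjoint edges ([turan_copies_path_lower]).

    Upper bound. Let n be the number of vertices, E an extremal edge set, and L
    the set of vertices of degree more than c * n ^ (r - 2), for a large
    constant c. A vertex of L is the centre of a star that avoids any prescribed
    bounded set of other vertices ([star_at_high_degree]). If L has at least k2
    elements, delete k2 of them. What is left contains no k1 disjoint paths,
    since k2 stars centred at the deleted vertices could be added to them; this
    is the upper bound.

    If L has fewer than k2 elements, delete L. The remaining edge set E' has all
    its degrees at most c * n ^ (r - 2), so the deletion of a bounded set of
    vertices costs only O(n ^ (r - 2)) edges. Hence, if E' is larger than what
    an edge set of such degrees can have without containing a path or without
    containing a star, paths and stars can be taken out of it one by one, and
    the stars centred in L complete the forbidden hypergraph. A star-free
    hypergraph has O(n ^ (r - 2)) edges ([card_star_free]). A path-free one with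
    these degrees has at most 7/3 * n ^ (r - 1) / (r - 1)! + O(n ^ (r - 2))
    edges ([card_path_free]). So E' is at most of this size, which for large n
    is less than the number of r-sets meeting four given vertices, about
    4 * n ^ (r - 1) / (r - 1)!. As #|L| + 4 <= k2 + (2 * k1 - 1), all of E has
    at most as many edges as there are r-sets meeting k2 + (2 * k1 - 1) given
    vertices, and the lower bound for k1 paths finishes the proof.

    The estimate for path-free hypergraphs rests on heavy pairs, those that lie
    in a positive fraction of n ^ (r - 2) edges. Bounded degrees make every
    vertex have a bounded number of heavy partners. A path can leave an edge
    through a vertex without heavy partner in this edge, since the edges that
    lead back to the vertices already used are then few. For r >= 4 almost every
    edge has two such vertices. For r = 3 there is one more kind of edge, a
    heavy pair with a third vertex, and the path then alternates between third
    vertices and vertices that lie in several heavy pairs. *)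

Set Implicit Arguments.
Unset Strict Implicit.
Unset Printing Implicit Defensive.

(** * Greedy choice, peeling and counting *)

Definition embeds (V : finType) (E : {set {set V}}) (F : hypergraph)
    (f : vertex F -> V) : Prop :=
  injective f /\ forall e, e \in edges F -> f @: e \in E.

Lemma containsP (H F : hypergraph) :
  reflect (exists f : vertex F -> vertex H, embeds (edges H) f) (contains H F).
Proof.
apply: (iffP existsP) => [[f /andP[/injectiveP injf /forall_inP fE]]|[f [injf fE]]].
  by exists f.
exists [ffun x => f x]; apply/andP; split.
  by apply/injectiveP => x y; rewrite !ffunE => /injf.
apply/forall_inP => e /fE; rewrite (@eq_imset _ _ f [ffun x => f x]) // => x.
by rewrite ffunE.
Qed.

Lemma card_bigcup_leq (T I : finType) (A : {pred I}) (F : I -> {set T}) (b : nat) :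
  (forall i, i \in A -> #|F i| <= b) -> #|\bigcup_(i in A) F i| <= #|A| * b.
Proof.
move=> Fb; rewrite -sum_nat_const.
apply: (@leq_trans (\sum_(i in A) #|F i|)); last exact: leq_sum.
elim/big_rec2: _ => [|i y z _ le_zy]; first by rewrite cards0.
by rewrite (leq_trans (leq_card_setU _ _)) // leq_add2l.
Qed.

(** The members chosen before the i-th one cover at most [k * b] points
    altogether, so the next one may be required to avoid them. *)
Lemma greedy_family (V : finType) (X : Type) (im : X -> {set V})
    (P : nat -> X -> Prop) (k b : nat) :
    (forall i x, i < k -> P i x -> #|im x| <= b) ->
    (forall i (U : {set V}), i < k -> #|U| <= k * b ->
       exists2 x, P i x & [disjoint im x & U]) ->
  exists g : 'I_k -> X, (forall i : 'I_k, P i (g i)) /\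
    (forall i j, i != j -> [disjoint im (g i) & im (g j)]).
Proof.
move=> im_b ext.
suff: forall m, m <= k -> exists g : 'I_m -> X, (forall i : 'I_m, P i (g i)) /\
    (forall i j, i != j -> [disjoint im (g i) & im (g j)]) by exact.
elim=> [|m IHm] lt_mk; first by exists (fun i : 'I_0 => False_rect X (notF (valP i))); split; case.
have [g [Pg dis_g]] := IHm (ltnW lt_mk).
have [|x Px dis_x] := ext m (\bigcup_i im (g i)) lt_mk.
  apply: leq_trans (_ : m * b <= _); last by rewrite leq_mul2r (ltnW lt_mk) orbT.
  rewrite -[m in m * b]card_ord; apply: card_bigcup_leq => i _.
  by apply: im_b (Pg i); apply: ltn_trans (ltn_ord i) lt_mk.
exists (fun i => if unlift ord_max i is Some j then g j else x).
have dis_gx j : [disjoint im (g j) & im x].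
  rewrite disjoint_sym (disjointWr _ dis_x) //; exact: bigcup_sup.
split=> [i|i j].
  case: unliftP => [j ->|-> //]; rewrite (_ : nat_of_ord _ = j) ?Pg //=.
  by rewrite /bump leqNgt ltn_ord.
case: unliftP => [i' ->|->]; case: unliftP => [j' ->|->] //.
- by rewrite (inj_eq lift_inj); apply: dis_g.
- by move=> _; rewrite disjoint_sym.
- by rewrite eqxx.
Qed.

Lemma bin_leq_exp n k : 'C(n, k) <= n ^ k.
Proof.
rewrite (@leq_trans (n ^_ k)) //; first by rewrite -bin_ffact leq_pmulr ?fact_gt0.
elim: k => [|k IHk]; first by rewrite ffactn0.
by rewrite ffactnSr expnSr leq_mul // leq_subr.
Qed.

Lemma card_supersets_leq (V : finType) (A : {set V}) (k : nat) :
  #|[set e : {set V} | (A \subset e) && (#|e| == k + #|A|)]| <= #|V| ^ k.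
Proof.
rewrite -(@card_in_imset _ _ (fun e : {set V} => e :\: A)).
  apply: leq_trans (bin_leq_exp _ _); rewrite -card_draws.
  apply/subset_leq_card/subsetP => _ /imsetP[e /[!inE] /andP[sAe /eqP card_e] ->].
  by rewrite cardsD (setIidPr sAe) card_e addnK.
move=> e1 e2 /[!inE] /andP[sA1 _] /andP[sA2 _] eqD.
by rewrite -(setID e1 A) eqD -[RHS](setID e2 A) (setIidPr sA1) (setIidPr sA2).
Qed.

(** A token [i] used by fewer than [B i] members of the family can be disposed
    of by deleting these members, and this is paid for at most once per token.
    Rather than iterating deletions, the proof takes for [E'] a subfamily that
    maximizes its size plus the total price of the tokens it does not use. *)
Lemma peel (X I : finType) (R : I -> X -> bool) (B : I -> nat) (E : {set X}) :
  exists E' : {set X}, [/\ E' \subset E, #|E| <= #|E'| + \sum_i B i &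
    forall x i, x \in E' -> R i x -> B i <= #|[set y in E' | R i y]|].
Proof.
pose unused (E' : {set X}) i := [forall y in E', ~~ R i y].
pose weight (E' : {set X}) := #|E'| + \sum_(i | unused E' i) B i.
case: (@arg_maxnP _ E (fun E' : {set X} => E' \subset E) weight (subxx E)) => E' sE' maxE'.
exists E'; split=> // [|x i xE' Rix].
  rewrite (leq_trans (leq_addr (\sum_(i | unused E i) B i) _)) //.
  rewrite (leq_trans (maxE' E _)) // leq_add2l.
  by rewrite [leqRHS](bigID (unused E')) leq_addr.
rewrite leqNgt; apply/negP => lt_B.
pose E2 := [set y in E' | ~~ R i y].
have sE2 : E2 \subset E' by apply/subsetP => y /[!inE] /andP[].
have /maxE' : E2 \subset E by apply: subset_trans sE'.
have cardE' : #|E'| = #|[set y in E' | R i y]| + #|E2|.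
  rewrite -(cardsID [set y | R i y] E'); congr (_ + _); apply: eq_card => y;
    by rewrite !inE // andbC.
rewrite /weight; apply/negP; rewrite -ltnNge cardE' addnAC addnC ltn_add2l.
have uE2 : unused E2 i by apply/forall_inP => y /[!inE] /andP[].
rewrite (bigD1 i uE2) /= (leq_trans (n := B i + \sum_(j | unused E' j) B j)) ?ltn_add2r //.
rewrite leq_add2l; apply: (sub_le_big (le := leq)) => //= [m n|j].
  exact: leq_addr.
move=> uj; apply/andP; split.
  apply/forall_inP => y yE2; apply: (forall_inP uj); exact: (subsetP sE2).
by apply: contraL uj => /eqP ->; apply/forall_inPn; exists x; rewrite ?negbK.
Qed.

(** The set [e] is recovered from its [k] elements other than [a] and [b]: first
    [a] is a neighbour of one of these, namely of [p], then [b] is a neighbour of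
    one of the [k.+1] elements other than [b], namely of [q]. So two of the
    [k.+2] elements of [e] are chosen among boundedly many. *)
Lemma card_linked_sets (V : finType) (N : V -> {set V}) (D k : nat)
    (E : {set {set V}}) :
    (forall v, #|N v| <= D) -> (forall e, e \in E -> #|e| = k.+2) ->
    (forall e, e \in E -> exists a b p q,
       [/\ a \in e, b \in e, p \in e & q \in e] /\
       [/\ a != b, p != b, a \in N p :\ p & b \in N q :\ q]) ->
  #|E| <= #|V| ^ k * (k.+1 * D) ^ 2.
Proof.
move=> ND Ek linkE.
pose NN (A : {set V}) := \bigcup_(p in A) N p.
have card_NN (A : {set V}) : #|NN A| <= #|A| * D by apply: card_bigcup_leq.
pose F (A : {set V}) := \bigcup_(a in NN A) [set b |: (a |: A) | b in NN (a |: A)].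
have sEF : E \subset \bigcup_(A in [set A : {set V} | #|A| == k]) F A.
  apply/subsetP => e eE; have [a [b [p [q [[ae be pe qe]]]]]] := linkE e eE.
  rewrite !inE => -[neq_ab neq_pb /andP[neq_ap aN] /andP[neq_bq bN]].
  have aeb : a \in e :\ b by rewrite !inE neq_ab.
  have def_e : b |: (a |: (e :\ b :\ a)) = e by rewrite !setD1K.
  apply/bigcupP; exists (e :\ b :\ a).
    have := Ek e eE; rewrite inE (cardsD1 b) be (cardsD1 a (e :\ b)) aeb.
    by rewrite !add1n => -[->].
  apply/bigcupP; exists a.
    by apply/bigcupP; exists p; rewrite // !inE neq_pb pe eq_sym neq_ap.
  apply/imsetP; exists b; last by rewrite def_e.
  apply/bigcupP; exists q => //; rewrite setD1K // !inE qe andbT eq_sym //.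
apply: leq_trans (subset_leq_card sEF) _.
apply: leq_trans (card_bigcup_leq (b := (k.+1 * D) ^ 2) _) _; last first.
  by rewrite leq_mul2r card_draws bin_leq_exp orbT.
move=> A /[!inE] /eqP cardA; rewrite expnS expn1.
apply: leq_trans (card_bigcup_leq (b := k.+1 * D) _) _ => [a _|].
  apply: leq_trans (leq_imset_card _ _) _; apply: leq_trans (card_NN _) _.
  by rewrite leq_mul2r cardsU1 cardA -add1n leq_add2r leq_b1 orbT.
rewrite leq_mul2r (leq_trans (card_NN A)) ?orbT //.
by rewrite leq_mul2r cardA leqnSn orbT.
Qed.

(** * Linear stars *)

Lemma card_meeting (V : finType) (E : {set {set V}}) (W : {set V}) (b : nat) :
  (forall w, w \in W -> #|[set e in E | w \in e]| <= b) ->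
  #|[set e in E | ~~ [disjoint e & W]]| <= #|W| * b.
Proof.
move=> degb; apply: leq_trans (card_bigcup_leq degb); apply/subset_leq_card/subsetP => e.
by rewrite inE => /andP[eE /pred0Pn[w /andP[we wW]]]; apply/bigcupP; exists w; rewrite // inE eE.
Qed.

Lemma avoiding_edge (V : finType) (E : {set {set V}}) (W : {set V}) (b : nat) :
    (forall w, w \in W -> #|[set e in E | w \in e]| <= b) -> #|W| * b < #|E| ->
  exists2 e, e \in E & [disjoint e & W].
Proof.
move=> /card_meeting le_b lt_b; apply/exists_inP; apply: contraLR lt_b => /exists_inPn noE.
rewrite -leqNgt (leq_trans _ le_b) //; apply/subset_leq_card/subsetP => e eE.
by rewrite inE eE noE.
Qed.

Lemma codeg_leq (V : finType) (r : nat) (E : {set {set V}}) (u v : V) :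
    1 < r -> (forall e, e \in E -> #|e| = r) -> u != v ->
  #|[set e in E | (u \in e) && (v \in e)]| <= #|V| ^ (r - 2).
Proof.
move=> r_gt1 Er neq_uv; apply: leq_trans (card_supersets_leq [set u; v] _).
apply/subset_leq_card/subsetP => e /[!inE] /and3P[eE ue ve].
by rewrite cards2 neq_uv subnK // (Er e eE) eqxx andbT subUset !sub1set ue.
Qed.

Definition spanned (F : hypergraph) : Prop :=
  forall x : vertex F, exists2 e, e \in edges F & x \in e.

Definition avoiding (V : finType) (E : {set {set V}}) (U : {set V}) : {set {set V}} :=
  [set e in E | [disjoint e & U]].

Lemma embeds_avoid (V : finType) (E : {set {set V}}) (F : hypergraph)
    (U : {set V}) (f : vertex F -> V) :
  spanned F -> embeds (avoiding E U) f ->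
  embeds E f /\ forall x, f x \notin U.
Proof.
move=> spanF [injf fE]; split; first by split=> // e /fE /[!inE] /andP[].
move=> x; have [e /fE /[!inE] /andP[_ dis_e] xe] := spanF x.
by rewrite (disjointFr dis_e) // imset_f.
Qed.

Lemma spanned_star r l : 0 < l -> spanned (linear_star r l).
Proof.
case: l => // l _ [[i|]|[i j]].
- by exists (star_edge r i); rewrite ?imset_f // !inE eqxx orbT.
- by exists (star_edge r ord0); rewrite ?imset_f // !inE eqxx.
- by exists (star_edge r i); rewrite ?imset_f // !inE imset_f.
Qed.

Lemma spanned_path r l : 0 < l -> 1 < r -> spanned (linear_path r l).
Proof.
move=> l0 r1 x; have := in_setT x; rewrite -(path_edge_cover l0 r1) => /bigcupP[i _ xi].
by exists (path_edge r i); rewrite ?imset_f.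
Qed.

(** The centre goes to [v]; the element of index 0 in the enumeration of
    [g i :\ v] becomes the leaf of the i-th edge, and the others become its
    inserted vertices. *)
Lemma star_of_sunflower (V : finType) (r l : nat) (E : {set {set V}}) (v : V)
    (g : 'I_l -> {set V}) :
    1 < r -> (forall i, [/\ g i \in E, #|g i| = r & v \in g i]) ->
    (forall i j, i != j -> [disjoint g i :\ v & g j :\ v]) ->
  exists f : vertex (linear_star r l) -> V, embeds E f.
Proof.
move=> r1 gE dis_g.
pose h i k := nth v (enum (g i :\ v)) k.
have size_g i : size (enum (g i :\ v)) = r.-1.
  by have [_ gr vg] := gE i; rewrite -cardE; move: gr; rewrite (cardsD1 v) vg => <-.
have hg i k : k < r.-1 -> h i k \in g i :\ v.
  by move=> k_lt; rewrite -mem_enum mem_nth // size_g.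
have inj_h i j k m : k < r.-1 -> m < r.-1 -> h i k = h j m -> i = j /\ k = m.
  move=> k_lt m_lt eq_h; have eq_ij : i = j.
    apply/eqP/negPn/negP => /dis_g /disjointFr /(_ (hg i k k_lt)).
    by rewrite eq_h hg.
  split=> //; apply/eqP; rewrite -eq_ij in eq_h.
  by rewrite -(@nth_uniq _ v (enum (g i :\ v))) ?size_g ?enum_uniq //; apply/eqP.
have hv i k : k < r.-1 -> h i k <> v.
  by move=> k_lt eq_v; have := hg i k k_lt; rewrite eq_v !inE eqxx.
pose f (x : vertex (linear_star r l)) := match x with
  | inl None => v | inl (Some i) => h i 0 | inr (i, j) => h i j.+1 end.
have lt0 : 0 < r.-1 by lia.
have ltS (j : 'I_(r - 2)) : j.+1 < r.-1 by have := ltn_ord j; lia.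
have injf : injective f.
  case=> [[i|]|[i j]] [[i'|]|[i' j']] //=.
  - by move=> /inj_h [] // ->.
  - by move/(hv _ _ lt0).
  - by case/(inj_h _ _ _ _ lt0 (ltS _)).
  - by move/esym/(hv _ _ lt0).
  - by move/esym/(hv _ _ (ltS _)).
  - by case/(inj_h _ _ _ _ (ltS _) lt0).
  - by move/(hv _ _ (ltS _)).
  - by case/(inj_h _ _ _ _ (ltS _) (ltS _)) => -> [/val_inj ->].
exists f; split=> // _ /imsetP[i _ ->].
have [giE gr vg] := gE i; suff -> : f @: star_edge r i = g i by [].
apply/eqP; rewrite eqEcard card_imset // card_star_edge // gr leqnn andbT.
apply/subsetP => _ /imsetP[x xe ->]; move: xe; rewrite !inE => /orP[/orP[]/eqP->|] //=.
  by have /setD1P[] := hg i 0 lt0.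
by case/imsetP=> j _ -> /=; have /setD1P[] := hg i j.+1 (ltS j).
Qed.

Lemma star_at (V : finType) (r l : nat) (E : {set {set V}}) (v : V) :
    1 < r -> (forall e, e \in E -> #|e| = r) ->
    (forall W : {set V}, #|W| <= l * r ->
      exists2 e, (e \in E) && (v \in e) & [disjoint e :\ v & W]) ->
  exists f : vertex (linear_star r l) -> V, embeds E f.
Proof.
move=> r1 Er ext.
have [| |g [gE dis_g]] := @greedy_family V {set V} (fun e => e :\ v)
  (fun _ e => (e \in E) && (v \in e)) l r.
- by move=> _ e _ /andP[/Er <- _]; rewrite subset_leq_card ?subD1set.
- by move=> _ U _; apply: ext.
apply: star_of_sunflower dis_g => // i; have /andP[giE vg] := gE i.
by split; rewrite ?Er.
Qed.

(** Any vertex other than [v] lies in at most [#|V| ^ (r - 2)] of the edges at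
    [v], so a bounded set of vertices cannot meet all these edges if there are
    many of them. *)
Lemma star_at_high_degree (V : finType) (r l : nat) (E : {set {set V}}) (v : V)
    (U : {set V}) :
    1 < r -> 0 < l -> (forall e, e \in E -> #|e| = r) -> v \notin U ->
    (#|U| + l * r) * #|V| ^ (r - 2) < #|[set e in E | v \in e]| ->
  exists f : vertex (linear_star r l) -> V, embeds E f /\ forall x, f x \notin U.
Proof.
move=> r1 l0 Er vU lt_deg.
have [||f f_emb] := @star_at V r l (avoiding E U) v r1.
- by move=> e /[!inE] /andP[/Er].
- move=> W W_le.
  have [|| e /[!inE] /andP[eE ve] dis_e] :=
    @avoiding_edge V [set e in E | v \in e] (U :|: (W :\ v)) (#|V| ^ (r - 2)).
  + move=> w w_in; have neq_vw : v != w.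
      by apply: contraTneq w_in => <-; rewrite !inE (negPf vU) eqxx.
    apply: leq_trans (codeg_leq r1 Er neq_vw).
    by apply/subset_leq_card/subsetP => e /[!inE]; rewrite andbA.
  + apply: leq_ltn_trans lt_deg; rewrite leq_mul2r (leq_trans (leq_card_setU _ _)) ?orbT //.
    by rewrite leq_add2l (leq_trans _ W_le) // subset_leq_card ?subD1set.
  exists e; first by rewrite !inE eE ve andbT (disjointWr (subsetUl _ _) dis_e).
  rewrite -setI_eq0; apply/eqP/setP => x; rewrite !inE.
  apply/negP => /andP[/andP[xv xe] xW].
  by have := disjointFr dis_e xe; rewrite !inE xv xW orbT.
by exists f; apply: embeds_avoid f_emb; apply: spanned_star.
Qed.

(** If [v] is not the centre of a star, its edges all meet a bounded set [N v]
    away from [v]. Every edge [e] then carries a map [phi] without fixed points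
    such that [phi v] belongs to [N v]. As [e] has at least three vertices, two
    values of [phi] can be singled out that are linked to the rest of [e] in the
    way required by [card_linked_sets]. *)
Lemma card_star_free (V : finType) (r l : nat) (E : {set {set V}}) :
    2 < r -> (forall e, e \in E -> #|e| = r) ->
    ~ (exists f : vertex (linear_star r l) -> V, embeds E f) ->
  #|E| <= #|V| ^ (r - 2) * ((r - 1) * (l * r)) ^ 2.
Proof.
move=> r2 Er noS.
have covers v : exists W : {set V}, #|W| <= l * r /\
    forall e, e \in E -> v \in e -> exists2 a, a \in e & a \in W :\ v.
  have [/exists_inP[W W_le /forall_inP WE]|/exists_inPn noW] := boolP [exists W : {set V} in
      [set W : {set V} | #|W| <= l * r], [forall e in [set e in E | v \in e], ~~ [disjoint e :\ v & W]]].
    exists W; split=> [|e eE ve]; first by move: W_le; rewrite inE.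
    have /WE /pred0Pn[a /andP[]] : e \in [set e in E | v \in e].
      by rewrite inE eE.
    by rewrite /= !inE => /andP[neq_av ae] aW; exists a; rewrite // !inE neq_av.
  case: noS; apply: (@star_at V r l E v) => // [|W W_le]; first by lia.
  have /noW/forall_inPn[e] : W \in [set W : {set V} | #|W| <= l * r] by rewrite inE.
  by rewrite inE negbK => eE dis_e; exists e.
have [N /all_and2 [N_le NE]] := fin_all_exists covers.
have -> : r - 1 = (r - 2).+1 by lia.
apply: (@card_linked_sets V N) => // e eE; first by rewrite Er //; lia.
have [phi [phi_e phiN]] : exists phi : V -> V, (forall v, v \in e -> phi v \in e) /\
    (forall v, v \in e -> phi v \in N v :\ v).
  have /fin_all_exists[phi phiP] : forall v, exists a, v \in e -> a \in e /\ a \in N v :\ v.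
    move=> v; have [ve|] := boolP (v \in e); last by exists v.
    by have [a ae aN] := NE v e eE ve; exists a.
  by exists phi; split=> v /phiP[].
have phi_neq v : v \in e -> phi v != v by move=> /phiN /setD1P[].
suff [p [q [[pe qe] neq_phi neq_pq]]] : exists p q,
    [/\ (p \in e) /\ (q \in e), phi p != phi q & p != phi q].
  by exists (phi p), (phi q), p, q; do !split => //; rewrite ?phi_e ?phiN.
(* Follow [phi] from [x]. If it comes back to [x] after two steps, the two
   values must involve a third vertex [w]. *)
have /card_gt0P[x xe] : 0 < #|e| by rewrite Er //; lia.
have ye := phi_e x xe; have ze := phi_e _ ye; have nxy := phi_neq x xe; have nyz := phi_neq _ ye.
have [eq_xz|neq_xz] := eqVneq x (phi (phi x)); last first.
  by exists x, (phi x); split=> //; rewrite eq_sym.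
have /card_gt0P[w] : 0 < #|e :\ x :\ phi x|.
  have := Er e eE; rewrite (cardsD1 x) xe (cardsD1 (phi x)) in_setD1 nxy ye; lia.
rewrite !inE => /and3P[neq_wy neq_wx we].
have [eq_ux|neq_ux] := eqVneq (phi w) x.
  by exists w, x; split; rewrite ?eq_ux // eq_sym.
by exists w, (phi x); rewrite -eq_xz.
Qed.

(** * Building linear paths step by step *)

(** The list [rcons s y] enumerates the vertices of a linear path along the
    path, so that consecutive edges are intervals of [r] entries sharing one
    entry. The end [y], where the path is to be continued, is kept apart. *)
Definition linear_chain (V : finType) (r : nat) (E : {set {set V}}) (i : nat)
    (s : seq V) (y : V) : Prop :=
  [/\ uniq (rcons s y), size s = i * r.-1 &
      forall j, j < i -> [set x in take r (drop (j * r.-1) (rcons s y))] \in E].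

Lemma chain_embeds (V : finType) (r l : nat) (E : {set {set V}}) (s : seq V) (y : V) :
  0 < r -> linear_chain r E l s y -> exists f : vertex (linear_path r l) -> V, embeds E f.
Proof.
move=> r0 [uniq_s size_s sE].
pose f (v : 'I_(l * r.-1).+1) := nth y (rcons s y) v.
have size_sy : size (rcons s y) = (l * r.-1).+1 by rewrite size_rcons size_s.
have injf : injective f.
  move=> v w /eqP; rewrite nth_uniq ?size_sy ?ltn_ord // => /eqP; exact: val_inj.
exists f; split=> // _ /imsetP[i _ ->].
suff -> : f @: path_edge r i = [set x in take r (drop (i * r.-1) (rcons s y))] by apply: sE.
apply/eqP; rewrite eqEcard card_imset // card_path_edge //; apply/andP; split; last first.
  by rewrite cardsE (leq_trans (card_size _)) // size_take_min geq_minl.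
apply/subsetP => _ /imsetP[v /[!inE] /andP[le_v v_le] ->].
have v_lt : v - i * r.-1 < r by move: v_le; rewrite mulSn; lia.
rewrite /f -(subnKC le_v) -nth_drop -(nth_take _ v_lt) mem_nth //.
by rewrite size_take_min leq_min v_lt size_drop size_sy ltn_sub2r // ltnS; have := ltn_ord v; lia.
Qed.

Lemma chain_extend (V : finType) (r i : nat) (E : {set {set V}}) (s : seq V)
    (y z : V) (e : {set V}) :
    0 < r -> linear_chain r E i s y -> e \in E -> #|e| = r -> y \in e ->
    z \in e :\ y -> [disjoint e :\ y & [set x in rcons s y]] ->
  exists t, linear_chain r E i.+1 t z /\
    [set x in rcons t z] = [set x in rcons s y] :|: e.
Proof.
move=> r0 [uniq_s size_s sE] eE er ye ze dis_e.
pose w := rcons (enum (e :\ y :\ z)) z.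
have mem_w x : (x \in w) = (x \in e :\ y).
  rewrite mem_rcons inE mem_enum in_setD1.
  by case: eqVneq => [->|] //=; rewrite ze.
have uniq_w : uniq w by rewrite rcons_uniq enum_uniq mem_enum !inE eqxx.
have size_w : size w = r.-1.
  by rewrite size_rcons -cardE -er (cardsD1 y e) ye (cardsD1 z (e :\ y)) ze.
have sw : rcons (rcons s y ++ enum (e :\ y :\ z)) z = rcons s y ++ w by rewrite rcons_cat.
exists (rcons s y ++ enum (e :\ y :\ z)); split; last first.
  apply/setP => x; rewrite sw !inE mem_cat mem_w in_setD1.
  by case: eqVneq => // ->; rewrite mem_rcons inE eqxx.
have ne_x (x : V) : x \in w -> x \notin rcons s y.
  by rewrite mem_w => /(disjointFr dis_e); rewrite inE => ->.
split; rewrite ?sw.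
- rewrite cat_uniq uniq_s uniq_w andbT; apply/hasPn => x; exact: ne_x.
- have := size_w; rewrite size_cat /w !size_rcons size_s mulSn => <-; lia.
- move=> j; rewrite ltnS leq_eqVlt => /orP[/eqP->|lt_ji].
    rewrite -cats1 -catA drop_size_cat // take_oversize /=; last by rewrite size_w; lia.
    suff -> : [set x in y :: w] = e by [].
    apply/setP => x; rewrite !inE mem_w in_setD1.
    by case: eqVneq => // ->; rewrite ye.
  have le1 : j * r.-1 + r.-1 <= i * r.-1 by rewrite addnC -mulSn leq_mul2r lt_ji orbT.
  rewrite drop_cat size_rcons size_s ifT; last by lia.
  rewrite take_cat size_drop size_rcons size_s.
  case: ltnP => [_|le2]; first exact: sE.
  have := sE j lt_ji; have -> : r - ((i * r.-1).+1 - j * r.-1) = 0 by lia.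
  by rewrite take0 cats0 take_oversize // size_drop size_rcons size_s.
Qed.

(** The invariant [I U y] makes the possibility of continuing from the end [y]
    depend on the set [U] of all vertices used so far. Since [U] has at most
    [l * r] elements until the path is complete, nothing is asked for larger
    sets. *)
Lemma greedy_path (V : finType) (r l : nat) (E : {set {set V}})
    (I : {set V} -> V -> Prop) (y0 : V) :
    0 < r -> (forall e, e \in E -> #|e| = r) ->
    (forall (U : {set V}) y, #|U| <= l * r -> I U y -> exists e z,
      [/\ e \in E, y \in e, [disjoint e :\ y & U], z \in e :\ y & I (U :|: e) z]) ->
  I [set y0] y0 -> exists f : vertex (linear_path r l) -> V, embeds E f.
Proof.
move=> r0 Er ext I0.
suff [s [y [chain_s _]]] : exists s y, linear_chain r E l s y /\ I [set x in rcons s y] y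
  by apply: chain_embeds chain_s.
suff: forall i, i <= l -> exists s y, linear_chain r E i s y /\ I [set x in rcons s y] y by exact.
elim=> [|i IHi] i_lt.
  exists [::], y0; split; first by split.
  by rewrite (_ : [set x in rcons [::] y0] = [set y0]) //; apply/setP => x; rewrite !inE.
have [s [y [chain_s Iy]]] := IHi (ltnW i_lt).
have [|e [z [eE ye dis_e ze Iz]]] := ext _ _ _ Iy.
  rewrite cardsE (leq_trans (card_size _)) //; case: chain_s => _ size_s _.
  rewrite size_rcons size_s; have := leq_mul i_lt (leqnn r); rewrite mulSn.
  have := leq_mul (leqnn i) (leq_pred r); lia.
have [t [chain_t eq_t]] := chain_extend r0 chain_s eE (Er e eE) ye ze dis_e.
by exists t, z; rewrite eq_t.
Qed.

(** After peeling, a vertex that is light in one edge is light in more than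
    [l * r * b] edges. At most [l * r * b] of these meet the vertices already
    used elsewhere, so the path can be continued at a light vertex, and the new
    edge has another light vertex to go on from. *)
Lemma card_two_light_path_free (V : finType) (r l b : nat) (E : {set {set V}})
    (light : V -> {set V} -> bool) :
    0 < r -> (forall e, e \in E -> #|e| = r) ->
    (forall y e, light y e -> y \in e) ->
    (forall y u, u != y -> #|[set e in E | light y e && (u \in e)]| <= b) ->
    (forall e, e \in E -> exists y z, [/\ y != z, light y e & light z e]) ->
    ~ (exists f : vertex (linear_path r l) -> V, embeds E f) ->
  #|E| <= #|V| * (l * r * b + 1).
Proof.
move=> r0 Er light_in light_b two_light noP.
have [E' [sE' le_E E'deg]] := peel light (fun=> l * r * b + 1) E.
rewrite sum_nat_const in le_E; apply: leq_trans le_E _; suff -> : E' = set0 by rewrite cards0.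
apply/eqP/set0Pn => -[e0 e0E']; case: noP.
have [y0 [_ [_ y0e _]]] := two_light e0 (subsetP sE' _ e0E').
apply: (@greedy_path V r l E (fun _ y => exists2 e, e \in E' & light y e) y0) => //; last by exists e0.
move=> U y U_le [e1 e1E' ye1].
have [||e] := @avoiding_edge V [set e in E' | light y e] (U :\ y) b.
- move=> w /setD1P[neq_wy _]; apply: leq_trans (light_b y w neq_wy).
  apply/subset_leq_card/subsetP => e /[!inE] /andP[/andP[/(subsetP sE') -> ->] ->] //.
- apply: leq_trans (E'deg e1 y e1E' ye1); rewrite addn1 ltnS leq_mul2r.
  by rewrite (leq_trans (subset_leq_card (subD1set _ _))) ?orbT.
rewrite inE => /andP[eE' ye] dis_e.
have eE := subsetP sE' _ eE'.
have dis_eU : [disjoint e :\ y & U].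
  rewrite -setI_eq0; apply/eqP/setP => x; rewrite !inE.
  apply/negP => /andP[/andP[xy xe] xU].
  by have := disjointFr dis_e xe; rewrite !inE xy xU.
have [z [ze neq_zy]] : exists z, light z e /\ z != y.
  have [z1 [z2 [neq12 l1 l2]]] := two_light e eE.
  by have [eq1|] := eqVneq z1 y; [exists z2; rewrite -eq1 eq_sym|exists z1].
exists e, z; split=> //; first exact: light_in.
  by rewrite !inE neq_zy light_in.
by exists e.
Qed.

(** * Triples made of a heavy pair and a third vertex *)

(** [N v] stands for the set of heavy partners of [v], and an edge consists of a
    heavy pair [x], [y] and a vertex [z] without heavy partner in it. The path
    alternates between two kinds of steps: from [z] it uses an edge [z], [x],
    [y] and leaves it at [y]; from there it uses an edge [y], [w], [z'] with
    another partner [w] of [y] and leaves it at [z']. The second step requires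
    more edges at [y] than the at most [#|V|] edges that contain [x] as well;
    peeling down to this situation is responsible for the quadratic term. *)
Lemma card_heavy_pair_path_free (V : finType) (l D : nat) (E : {set {set V}})
    (N : V -> {set V}) :
    (forall u v, (u \in N v) = (v \in N u)) -> (forall v, v \notin N v) ->
    (forall v, #|N v| <= D) ->
    (forall e, e \in E -> #|e| = 3) ->
    (forall e, e \in E -> exists x y z,
       [/\ e = [set x; y; z], y \in N x, z \notin N x, z \notin N y & (z != x) && (z != y)]) ->
    ~ (exists f : vertex (linear_path 3 l) -> V, embeds E f) ->
  #|E| <= #|V| * (l * 3 * D.+1 * D + 1) + #|V| * (#|V| + l * 3 * D + 1).
Proof.
move=> symN irrN ND E3 shape noP.
(* In an edge, [z] is light and [x], [y] are paired. *)
pose light z (e : {set V}) := (z \in e) && [disjoint e & N z].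
pose paired y (e : {set V}) := (y \in e) && ~~ [disjoint e & N y].
have light_rest e z w : e \in E -> light z e -> w \in e -> w != z ->
    exists2 x, x \in N w & e = [set z; w; x].
  move=> eE; have [x [y [t [def_e yx tx ty /andP[nx ny]]]]] := shape e eE.
  have xe : x \in e by rewrite def_e !inE eqxx.
  have ye : y \in e by rewrite def_e !inE eqxx orbT.
  case/andP=> ze dis_z we neq_wz; have def_z : z = t.
    move: ze; rewrite def_e !inE => /orP[/orP[]|] /eqP // eq_z.
      by have := disjointFr dis_z ye; rewrite eq_z yx.
    by have := disjointFr dis_z xe; rewrite eq_z symN yx.
  move: we neq_wz; rewrite def_e def_z !inE => /orP[/orP[]|] /eqP ->; rewrite ?eqxx // => _.
    by exists y; rewrite // setUC setUA.
  by exists x; rewrite 1?symN // setUC setUA setUAC.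
have paired_rest e y : e \in E -> paired y e ->
    exists w z, [/\ w \in N y, e = [set y; w; z], light z e, z != y & z \notin N y].
  move=> eE; have [x [w [z [def_e wx zx zw /andP[nx nw]]]]] := shape e eE.
  have lz : light z e.
    rewrite /light {1}def_e !inE eqxx orbT /=; apply/pred0Pn => -[t /andP[/=]].
    rewrite def_e !inE => /orP[/orP[]|] /eqP ->; rewrite ?(negPf (irrN z)) //.
      by rewrite symN (negPf zx).
    by rewrite symN (negPf zw).
  case/andP=> ye not_dis; move: (ye); rewrite {1}def_e !inE => /orP[/orP[]|] /eqP eq_y.
  - by exists w, z; rewrite eq_y.
  - exists x, z; rewrite eq_y; split=> //; first by rewrite symN.
    by rewrite def_e; congr (_ :|: _); rewrite setUC.
  - by case/andP: lz; rewrite -eq_y (negPf not_dis).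
(* The tokens [inl z] and [inr y] stand for [z] being light and [y] being paired
   in an edge. *)
have [E' [sE' le_E E'deg]] := peel
  (fun (i : V + V) e => match i with inl z => light z e | inr y => paired y e end)
  (fun i => match i with inl _ => l * 3 * D.+1 * D + 1
                       | inr _ => #|V| + l * 3 * D + 1 end) E.
rewrite big_sumType /= !sum_nat_const in le_E.
apply: leq_trans le_E _; suff -> : E' = set0 by rewrite cards0.
apply/eqP/set0Pn => -[e0 e0E']; case: noP.
have [x0 [y0 [z0 [def_e0 yx0 zx0 zy0 nz0]]]] := shape e0 (subsetP sE' _ e0E').
have [w0 [z1 [_ _ lz1 _ _]]] : exists w z,
    [/\ w \in N x0, e0 = [set x0; w; z], light z e0, z != x0 & z \notin N x0].
  apply: paired_rest; rewrite ?(subsetP sE') // /paired def_e0 !inE eqxx /=.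
  by apply/pred0Pn; exists y0; rewrite /= !inE eqxx yx0 orbT.
(* A paired end must have only one partner [x] among the vertices used so far:
   then any edge at [y] that avoids [x] brings in a new partner. *)
pose good_end (U : {set V}) y :=
  (exists2 e, e \in E' & light y e) \/
  (exists2 e, e \in E' & paired y e) /\
  (exists x, [/\ x \in U, x != y & forall u, u \in U -> u \in N y -> u = x]).
apply: (@greedy_path V 3 l E good_end z1) => //; last by left; exists e0.
move=> U y U_le [[e1 e1E' ye1]|[[e1 e1E' ye1] [x [xU neq_xy Nx]]]].
  (* The new edge also avoids the partners of the used vertices, so that its next
     end has no used partner outside this edge. *)
  pose W := (U :|: \bigcup_(u in U) N u) :\ y.
  have W_le : #|W| <= l * 3 * D.+1.
    apply: leq_trans (subset_leq_card (subD1set _ _)) _.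
    apply: leq_trans (leq_card_setU _ _) _; rewrite mulnS leq_add //.
    by apply: leq_trans (card_bigcup_leq (b := D) _) _; rewrite // leq_mul2r U_le orbT.
  have [||e] := @avoiding_edge V [set e in E' | light y e] W D.
  - move=> w /setD1P[neq_wy _]; apply: leq_trans (ND w).
    apply: leq_trans (leq_imset_card (fun x => [set y; w; x]) (mem (N w))).
    apply/subset_leq_card/subsetP => e /[!inE] /andP[/andP[/(subsetP sE') eE ly] we].
    by have [x xN ->] := light_rest e y w eE ly we neq_wy; apply: imset_f.
  - apply: leq_trans (E'deg e1 (inl y) e1E' ye1); rewrite addn1 ltnS leq_mul2r.
    by rewrite W_le orbT.
  rewrite inE => /andP[eE' ly] dis_e; have eE := subsetP sE' _ eE'.
  have ye : y \in e by case/andP: ly.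
  have dis_eW x : x \in e -> x != y -> (x \notin U) && (x \notin \bigcup_(u in U) N u).
    move=> xe neq_xy; have := disjointFr dis_e xe.
    by rewrite !inE neq_xy /= -negb_or => ->.
  have [w we neq_wy] : exists2 w, w \in e & w != y.
    have /card_gt0P[w] : 0 < #|e :\ y|
      by rewrite -(ltn_add2l (y \in e)) -cardsD1 E3 // ye.
    by rewrite !inE => /andP[]; exists w.
  have [x xN def_e] := light_rest e y w eE ly we neq_wy.
  have xe : x \in e by rewrite def_e !inE eqxx orbT.
  have dis_N := disjointFr (proj2 (andP ly)).
  exists e, w; split=> //.
  - rewrite -setI_eq0; apply/eqP/setP => t; rewrite !inE.
    by apply/negP => /andP[/andP[ty te] tU]; case/andP: (dis_eW t te ty); rewrite tU.
  - by rewrite !inE neq_wy.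
  right; split.
    by exists e; rewrite // /paired we; apply/pred0Pn; exists x; rewrite /= xe.
  exists x; split=> [||u].
  - by rewrite inE xe orbT.
  - by apply: contraTneq xN => ->.
  rewrite inE def_e !inE => /orP[uU uN|].
    case/andP: (dis_eW w we neq_wy) => _ /bigcupP[]; exists u => //; by rewrite symN.
  case/orP=> [/orP[]|] /eqP -> // uN; last by rewrite (negPf (irrN w)) in uN.
  by have := dis_N w we; rewrite symN uN.
pose Ey := [set e in E' | paired y e].
pose Ex := [set e in Ey | x \in e].
pose EU := [set e in Ey | (x \notin e) && ~~ [disjoint e :\ y & U]].
have le_Ex : #|Ex| <= #|V|.
  rewrite -[#|V|]expn1 -[1]/(3 - 2); apply: leq_trans (codeg_leq _ E3 neq_xy) => //.
  apply/subset_leq_card/subsetP => e /[!inE] /andP[/andP[/(subsetP sE') -> /andP[-> _]] ->] //.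
(* Such an edge consists of [y], a partner [w] of [y], and a vertex of [U]; [w]
   is not in [U], for it would be [x]. *)
have le_EU : #|EU| <= l * 3 * D.
  apply: (@leq_trans (#|U| * D)); last by rewrite leq_mul2r U_le orbT.
  apply: leq_trans (card_bigcup_leq (F := fun u => [set [set y; w; u] | w in N y]) _).
    apply/subset_leq_card/subsetP => e /[!inE] /andP[/andP[eE' py] /andP[xe dis_e]].
    have eE := subsetP sE' _ eE'.
    have [w [z [wN def_e _ _ _]]] := paired_rest e y eE py.
    case/pred0Pn: dis_e => u /andP[/= /setD1P[neq_uy ue] uU].
    apply/bigcupP; exists u => //; apply/imsetP; exists w => //.
    move: ue neq_uy; rewrite {1}def_e !inE => /orP[/orP[]|] /eqP eq_u; rewrite ?eq_u ?eqxx //.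
    by have := Nx u uU; rewrite eq_u => /(_ wN) eq_w; rewrite def_e !inE -eq_w eqxx orbT in xe.
  by move=> u _; apply: leq_trans (leq_imset_card _ _) (ND y).
have /card_gt0P[e] : 0 < #|Ey :\: (Ex :|: EU)|.
  rewrite -(ltn_add2l #|Ey :&: (Ex :|: EU)|) addn0 cardsID.
  apply: leq_trans (E'deg e1 (inr y) e1E' ye1); rewrite addn1 ltnS.
  apply: leq_trans (subset_leq_card (subsetIr _ _)) _.
  by apply: leq_trans (leq_card_setU _ _) _; apply: leq_add.
rewrite !inE => /andP[+ /andP[eE' py]]; rewrite eE' py /=.
rewrite negb_or negb_and => /andP[xe]; rewrite xe /= negbK => dis_e.
have [w [z [wN def_e lz neq_zy zN]]] := paired_rest e y (subsetP sE' _ eE') py.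
have ye : y \in e by case/andP: py.
exists e, z; split=> //; first exact: (subsetP sE').
  by rewrite !inE neq_zy /=; case/andP: lz.
by left; exists e.
Qed.

(** * Path-free hypergraphs with small degrees *)

(** The vertices that share with [v] at least the fraction [1 / h] of
    [#|V| ^ (r - 2)] edges. *)
Definition heavy_nbrs (V : finType) (r h : nat) (E : {set {set V}}) (v : V) : {set V} :=
  [set u | (u != v) && (#|V| ^ (r - 2) <= h * #|[set e in E | (u \in e) && (v \in e)]|)].

Lemma heavy_nbrs_sym (V : finType) r h (E : {set {set V}}) u v :
  (u \in heavy_nbrs r h E v) = (v \in heavy_nbrs r h E u).
Proof.
rewrite !inE eq_sym; congr (_ && (_ <= _ * _)).
by apply: eq_card => e; rewrite !inE andbA [in RHS]andbA andbAC.
Qed.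

Lemma sum_degrees (V : finType) (A : {set {set V}}) :
  \sum_u #|[set e in A | u \in e]| = \sum_(e in A) #|e|.
Proof.
under eq_bigr => u _.
  rewrite -sum1_card (eq_bigl (fun e => (e \in A) && (u \in e))); last by move=> e; rewrite inE.
over.
rewrite (exchange_big_dep (mem A)) /=; last by move=> u e _ /andP[].
by apply: eq_bigr => e eA; rewrite -sum1_card; apply: eq_bigl => u; rewrite eA.
Qed.

(** The codegrees of [v] with all vertices sum up to [r] times the degree of
    [v], and each heavy partner contributes at least [#|V| ^ (r - 2) / h]. *)
Lemma card_heavy_nbrs (V : finType) (r h d : nat) (E : {set {set V}}) (v : V) :
    0 < #|V| -> (forall e, e \in E -> #|e| = r) ->
    #|[set e in E | v \in e]| <= d * #|V| ^ (r - 2) ->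
  #|heavy_nbrs r h E v| <= h * (r * d).
Proof.
move=> V0 Er deg_v; rewrite -(@leq_pmul2r (#|V| ^ (r - 2))) ?expn_gt0 ?V0 //.
rewrite -sum_nat_const.
apply: (@leq_trans (\sum_u h * #|[set e in [set e in E | v \in e] | u \in e]|)).
  rewrite [leqRHS](bigID (mem (heavy_nbrs r h E v))) /=.
  rewrite (leq_trans _ (leq_addr _ _)) //; apply: leq_sum => u /[!inE] /andP[_].
  move=> /leq_trans -> //; rewrite leq_mul2l; apply/orP; right.
  by apply/subset_leq_card/subsetP => e /[!inE] /and3P[-> -> ->].
rewrite -big_distrr /= -!mulnA leq_mul2l; apply/orP; right.
rewrite sum_degrees (eq_bigr (fun=> r)); last by move=> e /[!inE] /andP[/Er].
by rewrite sum_nat_const mulnC leq_mul2l deg_v orbT.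
Qed.

(** When [N] is symmetric and irreflexive, this says that [e] contains two
    different pairs of neighbours. They are oriented from [p] to [a] and from [q]
    to [b] in the way that [card_linked_sets] needs. *)
Definition linked (V : finType) (N : V -> {set V}) (e : {set V}) : bool :=
  [exists a in e, exists b in e, exists p in e, exists q in e,
     [&& a != b, p != b, a \in N p & b \in N q]].

(** A neighbour of [z] in [e] would give a second pair besides [x], [y]. *)
Lemma two_heavy_pairs (V : finType) (N : V -> {set V}) (e : {set V}) (x y z : V) :
    (forall u v, (u \in N v) = (v \in N u)) -> (forall v, v \notin N v) ->
    ~~ linked N e ->
    x \in e -> y \in e -> z \in e -> y \in N x -> z != x -> z != y ->
  [disjoint e & N z].
Proof.
move=> symN irrN + xe ye ze yx zx zy; apply: contraNT => /pred0Pn[t /= /andP[te tz]].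
apply/exists_inP; exists y => //; apply/exists_inP; exists z => //.
apply/exists_inP; exists x => //; apply/exists_inP; exists t => //.
by rewrite eq_sym zy eq_sym zx yx symN tz.
Qed.

(** The edges are of three kinds. Those containing two heavy pairs are
    O(n ^ (r - 2)), by [card_linked_sets]. Those with at least two light vertices,
    that is, vertices without heavy partner in the edge, are handled by
    [card_two_light_path_free], where an edge at a light vertex [y] meets another
    given vertex only in codegree less than [#|V| ^ (r - 2) / h]. Any other edge
    contains exactly one heavy pair and at most one further vertex, so [r] is 3
    and [card_heavy_pair_path_free] applies.

    In the coefficient 7, after multiplication by [3 * (r.-1)`!], the third kind
    accounts for 6 and the second kind for 1, thanks to the factor [r`!] in
    [h]. *)
Lemma card_path_free (r l c : nat) :
    2 < r -> 0 < l ->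
  exists C, forall (V : finType) (E : {set {set V}}),
    (forall e, e \in E -> #|e| = r) ->
    (forall v, #|[set e in E | v \in e]| <= c * #|V| ^ (r - 2)) ->
    ~ (exists f : vertex (linear_path r l) -> V, embeds E f) ->
  3 * (r.-1)`! * #|E| <= 7 * #|V| ^ r.-1 + C * #|V| ^ (r - 2).
Proof.
move=> r2 l0; pose h := l * r * r`!; pose D := h * (r * c).
pose K1 := ((r - 2).+1 * D) ^ 2; pose K3 := l * 3 * D.+1 * D + 1 + (l * 3 * D + 1).
exists (3 * (r.-1)`! * K1 + r`! + 6 * K3) => V E Er deg_E noP.
have [->|[e0 e0E]] := set_0Vmem E; first by rewrite cards0 muln0.
have V0 : 0 < #|V|.
  by rewrite (leq_trans _ (max_card (mem e0))) // Er //; apply: leq_trans r2.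
set n := #|V| in V0 *.
pose N := heavy_nbrs r h E.
have symN u v : (u \in N v) = (v \in N u) by apply: heavy_nbrs_sym.
have irrN v : v \notin N v by rewrite inE eqxx.
have ND v : #|N v| <= D by apply: card_heavy_nbrs.
pose light v (e : {set V}) := (v \in e) && [disjoint e & N v].
pose E1 := [set e in E | linked N e].
pose E2 := [set e in E | ~~ linked N e & 1 < #|[set v | light v e]|].
pose E3 := [set e in E | ~~ linked N e & #|[set v | light v e]| <= 1].
have cardE : #|E| = #|E1| + (#|E2| + #|E3|).
  rewrite -(cardsID [set e | linked N e] E) -(cardsID [set e : {set V} | 1 < #|[set v | light v e]|] (_ :\: _)).
  by congr (_ + (_ + _)); apply: eq_card => e; rewrite !inE ?[_ <= 1]leqNgt;
    case: (e \in E); case: (linked N e); case: (1 < _).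
have E1_le : #|E1| <= n ^ (r - 2) * K1.
  apply: (@card_linked_sets _ N) => // e; rewrite inE => /andP[eE]; first by rewrite Er //; lia.
  case/exists_inP=> a ae /exists_inP[b be /exists_inP[p pe /exists_inP[q qe]]].
  case/and4P=> ab pb aN bN; exists a, b, p, q; split=> //.
  split; rewrite // in_setD1 ?aN ?bN andbT.
    by apply: contraTneq aN => ->.
  by apply: contraTneq bN => ->.
have E2_le : r`! * #|E2| <= n ^ r.-1 + r`! * n ^ (r - 2).
  have r0 : 0 < r by apply: leq_trans r2.
  have h0 : 0 < h by rewrite !muln_gt0 l0 r0 fact_gt0.
  apply: (@leq_trans (r`! * (n * (l * r * (n ^ (r - 2) %/ h) + 1)))).
    rewrite leq_mul2l; apply/orP; right.
    apply: (@card_two_light_path_free V r l _ E2 light) => //.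
    - by move=> e /[!inE] /andP[/Er].
    - by move=> v e /andP[].
    - move=> y u neq_uy.
      have [heavy|] := boolP (u \in N y).
        rewrite (_ : [set _ in _ | _] = set0) ?cards0 //; apply/setP => e; rewrite !inE.
        apply/negP => /andP[_ /andP[/andP[_ dis_e] ue]].
        by rewrite (disjointFr dis_e) in heavy.
      rewrite inE neq_uy /= -ltnNge => /ltnW; rewrite mulnC -leq_divRL // => le_q.
      apply: leq_trans le_q; apply/subset_leq_card/subsetP => e /[!inE].
      by case/andP=> /andP[-> _] /andP[/andP[-> _] ->].
    - move=> e; rewrite inE => /and3P[_ _ /card_gt1P[x [y [lx ly xy]]]].
      by exists x, y; split=> //; [move: lx|move: ly]; rewrite inE.
    - by case=> f [injf fE]; apply: noP; exists f; split=> // e /fE /[!inE] /andP[].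
  have nr : n ^ r.-1 = n * n ^ (r - 2) by rewrite -expnS; congr (_ ^ _); lia.
  have le1 : n <= n ^ (r - 2).
    by rewrite -{1}[n]expn1 leq_pexp2l //; lia.
  rewrite nr mulnDr muln1 mulnDr leq_add // ?leq_mul2l ?le1 ?orbT //.
  rewrite mulnCA leq_mul2l; apply/orP; right.
  by rewrite mulnA [r`! * _]mulnC -/h mulnC leq_divM.
have E3_le : 3 * (r.-1)`! * #|E3| <= 6 * n ^ r.-1 + 6 * K3 * n ^ (r - 2).
  have pair e : e \in E3 -> exists x y, [/\ x \in e, y \in e :\ x, y \in N x &
      forall z, z \in e -> z != x -> z != y -> light z e].
    rewrite inE => /and3P[eE not_linked few].
    have /subsetPn[x xe] : ~~ (e \subset [set v | light v e]).
      apply: contraTN few => /subset_leq_card; rewrite Er // -ltnNge => /(leq_trans _) -> //.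
      exact: ltnW.
    rewrite inE /light xe /= => /pred0Pn[y /= /andP[ye yx]].
    exists x, y; split=> // [|z ze zx zy].
      by rewrite !inE ye andbT; apply: contraTneq yx => ->.
    by rewrite ze (two_heavy_pairs _ _ not_linked xe ye).
  have [r3|r_neq3] := eqVneq r 3.
    have E3_3 e : e \in E3 -> #|e| = 3 by rewrite inE => /andP[/Er ->].
    have noP3 : ~ (exists f : vertex (linear_path 3 l) -> V, embeds E3 f).
      case=> f [injf fE]; apply: noP; move: (r) r3 => _ ->.
      by exists f; split=> // e /fE /[!inE] /andP[].
    have E3_le : #|E3| <= n * (l * 3 * D.+1 * D + 1) + n * (n + l * 3 * D + 1).
      apply: (card_heavy_pair_path_free symN irrN ND E3_3 _ noP3) => e eE3.
      have [x [y [xe ye yx rest]]] := pair e eE3.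
      have /cards1P[z def_z] : #|e :\ x :\ y| == 1.
        by have := E3_3 e eE3; rewrite (cardsD1 x) xe (cardsD1 y (e :\ x)) ye !add1n => -[->].
      have /setD1P[zy /setD1P[zx ze]] : z \in e :\ x :\ y by rewrite def_z set11.
      have /andP[_ dis_e] := rest z ze zx zy.
      have not_N w : w \in e -> z \notin N w.
        by move=> we; rewrite symN (disjointFr dis_e we).
      exists x, y, z; split; rewrite ?zx ?zy ?not_N //; last by case/setD1P: ye.
      by rewrite -setUA -def_z (setD1K ye) setD1K.
    have -> : r.-1 = 2 by rewrite r3.
    have -> : r - 2 = 1 by rewrite r3.
    rewrite expn1 -mulnn /K3 (_ : 3 * 2`! = 6) // -mulnA -mulnDr leq_mul2l /=.
    apply: leq_trans E3_le _; rewrite -mulnA; nia.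
  suff -> : E3 = set0 by rewrite cards0 muln0.
  apply/eqP/set0Pn => -[e eE3]; have [x [y [xe /setD1P[yx ye] _ rest]]] := pair e eE3.
  move: eE3; rewrite inE => /and3P[eE _ few].
  have : e \subset [set x; y] :|: [set v | light v e].
    apply/subsetP => z ze; rewrite in_setU in_set2 in_set.
    by case: eqVneq => //= zx; case: eqVneq => //= zy; apply: rest.
  move/subset_leq_card/leq_trans/(_ (leq_card_setU _ _)).
  rewrite Er // cards2 eq_sym yx => /leq_trans/(_ (leq_add (leqnn 2) few)).
  by move: r2 r_neq3; clear; lia.
have fact_r : 3 * (r.-1)`! <= r`!.
  by case: (r) r2 => // r' r2; rewrite factS leq_mul2r r2 orbT.
rewrite cardE 2!mulnDr.
have le1 := leq_mul (leqnn (3 * (r.-1)`!)) E1_le.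
have le2 := leq_trans (leq_mul fact_r (leqnn #|E2|)) E2_le.
move: le1 le2 E3_le; clear; lia.
Qed.

(** * Embeddings, relabelling and Turan numbers *)

Lemma sub_free (Fs : seq hypergraph) (H G : hypergraph) :
  (forall F, contains G F -> contains H F) -> free Fs H -> free Fs G.
Proof. by move=> sub; apply: sub_all => F; apply: contraNN; apply: sub. Qed.

Lemma embeds_union_l (V : finType) (E : {set {set V}}) (H G : hypergraph)
    (f : vertex (disjoint_union H G) -> V) :
  embeds E f -> embeds (F := H) E (fun x => f (inl x)).
Proof.
case=> injf fE; split=> [x y /injf[] //|e eH].
rewrite (imset_comp f inl); apply: fE; rewrite inE; apply/orP; left; exact: imset_f.
Qed.

Lemma embeds_union_r (V : finType) (E : {set {set V}}) (H G : hypergraph)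
    (f : vertex (disjoint_union H G) -> V) :
  embeds E f -> embeds (F := G) E (fun x => f (inr x)).
Proof.
case=> injf fE; split=> [x y /injf[] //|e eH].
rewrite (imset_comp f inr); apply: fE; rewrite inE; apply/orP; right; exact: imset_f.
Qed.

Lemma embeds_copies (V : finType) (E : {set {set V}}) (k : nat) (H : hypergraph)
    (f : vertex (copies k H) -> V) (i : 'I_k) :
  embeds E f -> embeds (F := H) E (fun x => f (i, x)).
Proof.
case=> injf fE; split=> [x y /injf[] //|e eH].
rewrite (imset_comp f (pair i)); apply: fE; apply/bigcupP; exists i => //; exact: imset_f.
Qed.

Lemma union_embeds (V : finType) (E : {set {set V}}) (H G : hypergraph)
    (f : vertex H -> V) (g : vertex G -> V) :
    embeds E f -> embeds E g -> (forall x y, f x != g y) ->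
  exists fg : vertex (disjoint_union H G) -> V, embeds E fg.
Proof.
move=> [injf fE] [injg gE] neq_fg.
exists (fun x => match x with inl v => f v | inr v => g v end); split.
  case=> x [] y //; first by move/injf->.
  - by move/eqP; rewrite (negPf (neq_fg x y)).
  - by move/esym/eqP; rewrite (negPf (neq_fg y x)).
  - by move/injg->.
by move=> _ /setUP[] /imsetP[e eH ->]; rewrite -imset_comp; [apply: fE | apply: gE].
Qed.

Lemma copies_embeds (V : finType) (E : {set {set V}}) (k : nat) (H : hypergraph)
    (f : 'I_k -> vertex H -> V) :
    (forall i, embeds E (f i)) -> (forall i j x y, i != j -> f i x != f j y) ->
  embeds (F := copies k H) E (fun p => f p.1 p.2).
Proof.
move=> fE neq_f; split.
  move=> [i x] [j y] /= eq_f; have [eq_ij|/neq_f/eqP/(_ eq_f)//] := eqVneq i j.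
  by move: eq_f; rewrite eq_ij; case: (fE j) => injf _ /injf->.
by move=> _ /bigcupP[i _ /imsetP[e eH ->]]; rewrite -imset_comp; apply: (proj2 (fE i)).
Qed.

Lemma disjoint_transversal (I V : finType) (f : I -> {set V}) (T : {set V}) :
    (forall i j, i != j -> [disjoint f i & f j]) ->
    (forall i, ~~ [disjoint f i & T]) ->
  #|I| <= #|T|.
Proof.
move=> dis_f meets.
have /fin_all_exists[t tP] : forall i, exists x, (x \in f i) && (x \in T).
  by move=> i; have /pred0Pn[x] := meets i; exists x.
rewrite -(@card_imset _ _ t) => [|i j eq_t].
  by apply/subset_leq_card/subsetP => _ /imsetP[i _ ->]; case/andP: (tP i).
apply/eqP/negPn/negP => /dis_f /disjointFr.
by move=> /(_ (t i)); rewrite {2}eq_t; case/andP: (tP i) => -> _; case/andP: (tP j) => -> _ /(_ isT).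
Qed.

Definition hitting (V : finType) (r : nat) (T : {set V}) : {set {set V}} :=
  [set e : {set V} | (#|e| == r) && ~~ [disjoint e & T]].

Lemma card_hitting (V : finType) (r : nat) (T : {set V}) :
  #|hitting r T| = 'C(#|V|, r) - 'C(#|V| - #|T|, r).
Proof.
have -> : #|V| - #|T| = #|~: T| by rewrite -(cardsC T) addKn.
rewrite -card_draws -cards_draws -(cardsID (hitting r T) [set A : {set V} | #|A| == r]).
rewrite -(@eq_card _ (hitting r T)) => [|e]; last first.
  by rewrite !inE andbA andbb.
rewrite -[X in _ + X](@eq_card _ [set A : {set V} | A \subset ~: T & #|A| == r]) ?addnK // => e.
by rewrite !inE subsets_disjoint setCK; case: (#|e| == r); rewrite ?andbT ?andbF ?negbK.
Qed.

Definition relabel (W V : finType) (h : W -> V) (E : {set {set W}}) : {set {set V}} :=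
  [set h @: (e : {set W}) | e in E].

Lemma exists_labelling (V : finType) (A : {set V}) (m : nat) :
  #|A| = m -> exists h : 'I_m -> V, injective h /\ h @: setT = A.
Proof.
move=> <-; exists enum_val; split; first exact: enum_val_inj.
apply/setP => x; apply/imsetP/idP => [[i _ ->]|xA]; first exact: enum_valP.
by exists (enum_rank_in xA x); rewrite ?enum_rankK_in.
Qed.

Lemma embeds_relabel (W V : finType) (h : W -> V) (E : {set {set W}})
    (F : hypergraph) (f : vertex F -> V) :
    injective h -> embeds (relabel h E) f -> (forall x, f x \in h @: setT) ->
  exists g : vertex F -> W, embeds E g.
Proof.
move=> injh [injf fE] fh.
have /fin_all_exists[g gP] : forall x, exists y, h y = f x.
  by move=> x; have /imsetP[y _ ->] := fh x; exists y.
exists g; split=> [x y eq_g|e /fE /imsetP[e0 e0E]].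
  by apply: injf; rewrite -!gP eq_g.
by rewrite -(eq_imset _ gP) (imset_comp h g) => /(imset_inj injh) ->.
Qed.

Lemma card_leq_turan (V : finType) (r m : nat) (A : {set V}) (E : {set {set V}})
    (Fs : seq hypergraph) :
    #|A| = m -> (forall e, e \in E -> (#|e| = r) /\ e \subset A) ->
    free Fs (Hypergraph E) ->
  #|E| <= turan r m Fs.
Proof.
move=> cardA EA freeE; have [h [injh imh]] := exists_labelling cardA.
pose E0 := [set h @^-1: e | e : {set V} in E].
have hK e : e \in E -> h @: (h @^-1: e) = e.
  case/EA=> _ /subsetP sA; apply/setP => x; apply/imsetP/idP => [[y /[!inE] ye ->] //|xe].
  by have := sA x xe; rewrite -imh => /imsetP[y _ eq_x]; exists y; rewrite // inE -eq_x.
have <- : #|E0| = #|E|.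
  by apply: card_in_imset => e1 e2 /hK {2}<- /hK {2}<- ->.
apply: leq_bigmax_cond; apply/andP; split.
  by apply/forall_inP => _ /imsetP[e eE ->]; rewrite -(card_imset _ injh) hK //; case/EA: eE => ->.
apply: sub_free freeE => F /containsP[f [injf fE]]; apply/containsP.
exists (h \o f); split; first exact: inj_comp.
by move=> e /fE /imsetP[e' e'E eq_e]; rewrite imset_comp eq_e hK.
Qed.

(** * Lower bounds *)

Lemma exists_subset_card (V : finType) (A : {set V}) (t : nat) :
  t <= #|A| -> exists2 T : {set V}, T \subset A & #|T| = t.
Proof.
move=> t_le; exists [set x in take t (enum A)].
  by apply/subsetP => x; rewrite inE => /mem_take; rewrite mem_enum.
by rewrite cardsE (card_uniqP _) ?take_uniq ?enum_uniq // size_takel -?cardE.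
Qed.

(** The first and the third edge of each copy of the path are disjoint, and both
    meet [T]. *)
Lemma copies_path_meets (V : finType) (r l k : nat) (T : {set V})
    (f : vertex (copies k (linear_path r l)) -> V) :
  1 < r -> 2 < l -> embeds (hitting r T) f -> 2 * k <= #|T|.
Proof.
move=> r1 l2 f_emb.
have l0 : 0 < l by apply: leq_trans l2.
(* [e false] is the first edge of the path and [e true] the third one. *)
pose e (b : bool) := path_edge r (if b then Ordinal l2 else Ordinal l0).
have dis_e b c : b != c -> [disjoint e b & e c].
  rewrite -setI_eq0; case: b c => [] [] // _; rewrite ?[e true :&: _]setIC;
    by rewrite path_edge_disjoint.
have injf := proj1 f_emb.
have -> : 2 * k = #|{: bool * 'I_k}| by rewrite card_prod card_bool card_ord.
apply: (@disjoint_transversal _ _ (fun p => [set f (p.2, x) | x in e p.1])) => [p q|p].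
  move=> neq_pq; apply/pred0Pn => -[_ /andP[/= /imsetP[x xe ->] /imsetP[y ye /injf[eq_i eq_xy]]]].
  have [eq_b|neq_b] := eqVneq p.1 q.1.
    by case/eqP: neq_pq; move: eq_b eq_i; case: (p) (q) => [? ?] [? ?] /= -> ->.
  by have := disjointFr (dis_e _ _ neq_b) xe; rewrite eq_xy ye.
have eP : e p.1 \in edges (linear_path r l) by apply: imset_f.
by have := proj2 (embeds_copies p.2 f_emb) (e p.1) eP; rewrite inE => /andP[].
Qed.

Lemma turan_copies_path_lower (r l k n : nat) :
    1 < r -> 2 < l -> 0 < k -> 2 * k - 1 <= n ->
  'C(n, r) - 'C(n - (2 * k - 1), r) <= turan r n [:: copies k (linear_path r l)].
Proof.
move=> r1 l2 k0 le_n.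
have [|T _ cardT] := @exists_subset_card 'I_n setT (2 * k - 1).
  by rewrite cardsT card_ord.
have := card_hitting r T; rewrite card_ord cardT => <-.
apply: leq_bigmax_cond; apply/andP; split.
  by apply/forall_inP => e; rewrite inE => /andP[].
rewrite /free /= andbT; apply/containsP => -[f /(copies_path_meets r1 l2)].
rewrite cardT; lia.
Qed.

(** Fewer than [k1 + k2] vertices in [T] cannot meet all the [k1 + k2] components
    of an embedded copy. A component that avoids [T] has all its edges in the
    relabelled [E0]. *)
Lemma hitting_relabel_free (V : finType) (r l k1 k2 m : nat) (T : {set V})
    (h : 'I_m -> V) (E0 : {set {set 'I_m}}) :
    1 < r -> 0 < l -> #|T| < k1 + k2 -> injective h -> h @: setT = ~: T ->
    free [:: linear_path r l; linear_star r l] (Hypergraph E0) ->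
  free [:: disjoint_union (copies k1 (linear_path r l)) (copies k2 (linear_star r l))]
    (Hypergraph (hitting r T :|: relabel h E0)).
Proof.
set P := linear_path r l; set S := linear_star r l.
move=> r1 l0 ltT injh imh /and3P[/containsP noP /containsP noS _].
rewrite /free /= andbT; apply/containsP => -[f f_emb].
have injf := proj1 f_emb.
have inside (F : hypergraph) (g : vertex F -> V) :
    embeds (hitting r T :|: relabel h E0) g ->
    [disjoint [set g x | x in setT] & T] -> exists g0 : vertex F -> 'I_m, embeds E0 g0.
  move=> [injg gE] dis_g.
  have gT x : g x \notin T by rewrite (disjointFr dis_g) // imset_f.
  apply: (@embeds_relabel _ _ h _ F g) => // [|x]; last by rewrite imh inE.
  split=> // e eF; have := gE e eF; rewrite !inE => /orP[/andP[_ /pred0Pn[_ /= /andP[/imsetP[x _ ->]]]]|//].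
  by rewrite (negPf (gT x)).
pose comp (c : 'I_k1 + 'I_k2) : {set V} := match c with
  | inl i => [set f (inl (i, x)) | x in setT]
  | inr i => [set f (inr (i, x)) | x in setT] end.
have [/existsP[[i|i] dis_i]|/existsPn meets] := boolP [exists c, [disjoint comp c & T]].
- by apply: noP; apply: inside dis_i; apply: embeds_copies (embeds_union_l f_emb).
- by apply: noS; apply: inside dis_i; apply: embeds_copies (embeds_union_r f_emb).
have : #|{: 'I_k1 + 'I_k2}| <= #|T|.
  apply: disjoint_transversal meets => c d neq_cd; apply/pred0Pn => -[z /andP[/=]].
  move: c d neq_cd => [i|i] [j|j] neq_ij /imsetP[x _ ->] /imsetP[y _ /injf] // [eq_ij _];
    by rewrite eq_ij eqxx in neq_ij.
by rewrite card_sum !card_ord leqNgt ltT.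
Qed.

Lemma turan_lower_bound (r l k1 k2 n : nat) :
    2 < r -> 0 < l -> 0 < k1 -> k1 + k2 <= n ->
  'C(n, r) - 'C(n - (k1 + k2 - 1), r)
      + turan r (n - (k1 + k2 - 1)) [:: linear_path r l; linear_star r l]
    <= turan r n [:: disjoint_union (copies k1 (linear_path r l)) (copies k2 (linear_star r l))].
Proof.
set P := linear_path r l; set S := linear_star r l.
move=> r2 l0 k0 le_n; set m := k1 + k2 - 1.
have r1 : 1 < r by apply: ltnW.
have [|T _ cardT] := @exists_subset_card 'I_n setT m.
  rewrite cardsT card_ord /m; lia.
have cardTC : #|~: T| = n - m by have := cardsC T; rewrite card_ord cardT => /(canRL (addKn _)).
have [h [injh imh]] := exists_labelling cardTC.
(* The empty hypergraph shows that the maximum is taken over a nonempty set. *)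
have [|E0 /andP[unifE0 freeE0] max_eq] := @eq_bigmax_cond {set {set 'I_(n - m)}}
    [pred E | uniform r (Hypergraph E) && free [:: P; S] (Hypergraph E)] (fun E => #|E|).
  apply/card_gt0P; exists set0; rewrite inE; apply/and3P; split.
  - by apply/forall_inP => e; rewrite inE.
  - apply/containsP => -[f [_ fE]].
    have /fE : path_edge r (Ordinal l0) \in edges P by apply: imset_f.
    by rewrite inE.
  - rewrite andbT; apply/containsP => -[f [_ fE]].
    have /fE : star_edge r (Ordinal l0) \in edges S by apply: imset_f.
    by rewrite inE.
have -> : turan r (n - m) [:: P; S] = #|E0| by exact: max_eq.
have dis_hr : [disjoint hitting r T & relabel h E0].
  apply/pred0Pn => -[e /= /andP[/[!inE] /andP[_ /pred0Pn[x /= /andP[xe xT]]] /imsetP[e0 _ eq_e]]].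
  move: xe; rewrite eq_e => /imsetP[y _ eq_x].
  have : x \in h @: setT by rewrite eq_x imset_f.
  by rewrite imh inE xT.
have card_relabel : #|relabel h E0| = #|E0| by apply: card_imset; apply: imset_inj.
have := card_hitting r T; rewrite card_ord cardT => <-.
rewrite -card_relabel -cardsUI.
rewrite (disjoint_setI0 dis_hr) cards0 addn0; apply: leq_bigmax_cond.
rewrite hitting_relabel_free ?cardT //; last by rewrite /m; lia.
rewrite andbT; apply/forall_inP => e /setUP[/[!inE] /andP[] // |/imsetP[e0 e0E ->]].
by rewrite card_imset //; apply: (forall_inP unifE0).
Qed.

(** * The upper bound *)

Lemma embeds_avoiding (V : finType) (E : {set {set V}}) (F : hypergraph)
    (U : {set V}) (f : vertex F -> V) :
  embeds E f -> (forall x, f x \notin U) -> embeds (avoiding E U) f.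
Proof.
move=> [injf fE] fU; split=> // e eF; rewrite inE fE //=.
by apply/pred0Pn => -[_ /andP[/imsetP[x _ ->] /=]]; rewrite (negPf (fU x)).
Qed.

Lemma embeds_sub (V : finType) (E E' : {set {set V}}) (F : hypergraph)
    (f : vertex F -> V) : E \subset E' -> embeds E f -> embeds E' f.
Proof. by move=> /subsetP sE [injf fE]; split=> // e /fE /sE. Qed.

Lemma spanned_copies k F : spanned F -> spanned (copies k F).
Proof.
move=> spanF [i x]; have [e eF xe] := spanF x.
exists [set (i, v) | v in e]; last exact: imset_f.
by apply/bigcupP; exists i; rewrite // imset_f.
Qed.

Lemma card_avoiding (V : finType) (E : {set {set V}}) (U : {set V}) (b : nat) :
    (forall v, #|[set e in E | v \in e]| <= b) ->
  #|E| <= #|avoiding E U| + #|U| * b.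
Proof.
move=> deg_b; rewrite -(cardsID [set e : {set V} | [disjoint e & U]] E) leq_add //.
  by apply/subset_leq_card/subsetP => e; rewrite !inE.
apply: leq_trans (card_meeting (E := E) (W := U) (b := b) _) => [|w _]; last exact: deg_b.
by apply/subset_leq_card/subsetP => e; rewrite !inE andbC.
Qed.

(** The vertices of [L] are reserved: the i-th copy uses no vertex of [L] outside
    its own share [c i], which no other copy can occupy before it. *)
Lemma greedy_embeddings (V : finType) (E : {set {set V}}) (F : hypergraph) (k : nat)
    (L : {set V}) (c : nat -> {set V}) :
    (forall i j, i != j -> [disjoint c i & c j]) ->
    (forall i (U : {set V}), i < k -> #|U| <= k * #|vertex F| ->
       exists f : vertex F -> V, [/\ embeds E f,
         forall x, f x \in L -> f x \in c i & forall x, f x \in U -> f x \in L]) ->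
  exists f : vertex (copies k F) -> V, embeds E f.
Proof.
move=> dis_c ext.
pose im (f : vertex F -> V) := [set f x | x in setT] :\: L.
have [||g [gP dis_g]] := @greedy_family V _ im
   (fun i f => embeds E f /\ forall x, f x \in L -> f x \in c i) k #|vertex F|.
- move=> i f _ _; apply: leq_trans (subset_leq_card (subsetDl _ _)) _.
  by apply: leq_trans (leq_imset_card _ _) _; rewrite cardsT.
- move=> i U i_lt U_le; have [f [f_emb fc fU]] := ext i U i_lt U_le.
  exists f; first by split.
  apply/pred0Pn => -[_ /andP[/= /setDP[/imsetP[x _ ->] fL] /fU]].
  by rewrite (negPf fL).
exists (fun p => g p.1 p.2); apply: copies_embeds => [i|i j x y neq_ij].
  by case: (gP i).
apply/eqP => eq_g; have gx : g i x \in [set g i x | x in setT] by apply: imset_f.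
have gy : g i x \in [set g j x | x in setT] by rewrite eq_g; apply: imset_f.
have [gL|gL] := boolP (g i x \in L).
  have [_ /(_ x gL) xc] := gP i; have [_ /(_ y)] := gP j.
  by rewrite -eq_g (disjointFr (dis_c i j neq_ij) xc) => /(_ gL).
by have := disjointFr (dis_g i j neq_ij) (x := g i x); rewrite !inE gL gx gy => /(_ isT).
Qed.

(** The first [#|L|] stars are centred at the elements of [L], where the degree is
    large, and the others, if any, are found away from [L]. The bound [M] leaves
    room for the set [U0] to be avoided, for all the stars, and for [L]. *)
Lemma embeds_stars (V : finType) (r l k m : nat) (E : {set {set V}}) (L U0 : {set V}) :
    let S := linear_star r l in
    let M := m + k * #|vertex S| + k in
    1 < r -> 0 < l -> (forall e, e \in E -> #|e| = r) ->
    #|L| <= k -> #|U0| <= m -> [disjoint L & U0] ->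
    (forall v, v \in L -> (M + l * r) * #|V| ^ (r - 2) < #|[set e in E | v \in e]|) ->
    (k <= #|L| \/ forall U : {set V}, #|U| <= M ->
       exists f : vertex S -> V, embeds (avoiding E U) f) ->
  exists f : vertex (copies k S) -> V, embeds (avoiding E U0) f.
Proof.
move=> S M r1 l0 Er L_le U0_le dis_LU0 deg_L k_or.
pose c i := [set x in L | index x (enum L) == i].
apply: (@greedy_embeddings V _ S k L c) => [i j neq_ij|i U i_lt U_le].
  apply/pred0Pn => -[x /=]; rewrite !inE => /andP[/andP[_ /eqP eq_i] /andP[_ /eqP eq_j]].
  by rewrite -eq_i -eq_j eqxx in neq_ij.
have W_le : #|(U :|: U0) :|: L| <= M.
  apply: leq_trans (leq_card_setU _ _) _; rewrite leq_add //.
  by apply: leq_trans (leq_card_setU _ _) _; rewrite addnC leq_add.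
have [i_ltL|i_geL] := ltnP i #|L|.
  have /card_gt0P[v0 _] : 0 < #|L| by apply: leq_ltn_trans i_ltL.
  pose v := nth v0 (enum L) i.
  have size_L : i < size (enum L) by rewrite -cardE.
  have vL : v \in L by rewrite -mem_enum mem_nth.
  have [||f [f_emb fW]] := @star_at_high_degree V r l E v (((U :|: U0) :|: L) :\ v) r1 l0 Er.
  - by rewrite !inE eqxx.
  - apply: leq_ltn_trans (deg_L v vL); rewrite leq_mul2r leq_add2r.
    by rewrite (leq_trans (subset_leq_card (subD1set _ _))) ?orbT.
  have only_v x : f x \in (U :|: U0) :|: L -> f x = v.
    by have := fW x; rewrite !in_setD1 negb_and negbK => /orP[/eqP //|/negPf->].
  exists f; split=> [|x fL|x fU].
  - apply: embeds_avoiding => // x; apply/negP => fU0.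
    have := only_v x; rewrite !inE fU0 orbT => /(_ isT) eq_fv.
    by rewrite eq_fv (disjointFr dis_LU0 vL) in fU0.
  - rewrite (only_v x) ?inE ?fL ?orbT // vL /= index_uniq ?enum_uniq //.
  - by rewrite (only_v x) // !inE fU.
case: k_or => [/(leq_trans i_lt)|/(_ _ W_le)[f f_emb]]; first by rewrite ltnNge i_geL.
have spanS : spanned S by apply: spanned_star.
have [f_embE f_notin] := embeds_avoid spanS f_emb.
exists f; split=> [|x fL|x fU].
- apply: embeds_avoiding => // x; apply: contraNN (f_notin x); rewrite !inE => ->.
  by rewrite orbT.
- by have := f_notin x; rewrite !inE fL orbT.
- by have := f_notin x; rewrite !inE fU.
Qed.

(** Bernoulli's inequality, freed of divisions. *)
Lemma exp_leq_sub x a d : x ^ d <= (x - a) ^ d + d * a * x ^ d.-1.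
Proof.
elim: d => [|d IHd]; first by rewrite !expn0 leq_addr.
rewrite expnS (leq_trans (leq_mul (leqnn x) IHd)) // mulnDr /=.
have le1 : x * (x - a) ^ d <= (x - a) ^ d.+1 + a * x ^ d.
  rewrite expnS; apply: (@leq_trans ((x - a + a) * (x - a) ^ d)).
    by rewrite leq_mul2r; apply/orP; right; lia.
  rewrite mulnDl leq_add2l leq_mul2l; apply/orP; right.
  by case: (d) => // d'; rewrite leq_exp2r // leq_subr.
apply: leq_trans (leq_add le1 (leqnn _)) _; rewrite -addnA leq_add2l.
case: (d) => [|d']; first by rewrite !mul0n muln0 addn0 mul1n.
by rewrite /= mulnCA -expnS -mulnDl [d'.+2 * a]mulSn.
Qed.

Lemma ffact_geq n d : (n - d) ^ d <= n ^_ d.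
Proof.
elim: d n => [|d IHd] n; first by rewrite expn0 ffactn0.
case: n => [|n]; first by rewrite sub0n exp0n.
rewrite ffactnS subSS expnS leq_mul //; lia.
Qed.

Lemma bin_gap m d t : t <= m -> t * 'C(m - t, d) <= 'C(m, d.+1) - 'C(m - t, d.+1).
Proof.
move=> t_le; rewrite leq_subRL ?leq_bin2l ?leq_subr //.
elim: t t_le => [|t IHt] t_lt; first by rewrite mul0n addn0 subn0.
apply: leq_trans (IHt (ltnW t_lt)).
have -> : m - t = (m - t.+1).+1 by lia.
rewrite binS mulSn addnA leq_add2l leq_mul2l; apply/orP; right.
by rewrite leq_bin2l.
Qed.

(** By [bin_gap], the difference of binomials is at least
    [4 * 'C(n - t - 4, r.-1)], so that the right-hand side is at least
    [12 * n ^ r.-1], up to a multiple of [n ^ (r - 2)]; and 12 exceeds 7. *)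
Lemma budget_asymptotic r k K :
    2 < r -> exists n0, forall n t, n0 <= n -> t <= k ->
  7 * n ^ r.-1 + K * n ^ (r - 2)
    <= 3 * (r.-1)`! * ('C(n - t, r) - 'C(n - t - 4, r)).
Proof.
case: r => [|d] // d1; rewrite (_ : d.+1 - 2 = d.-1) /=; last by lia.
(* Every factor of the falling factorial [(n - t - 4) ^_ d] is at least [n - a]. *)
pose a := k + 4 + d.
exists (K + 12 * (d * a) + k + 4) => n t n_ge t_le.
have gap : 4 * 'C(n - t - 4, d) <= 'C(n - t, d.+1) - 'C(n - t - 4, d.+1).
  by apply: bin_gap; lia.
have ff : (n - a) ^ d <= 'C(n - t - 4, d) * d`!.
  rewrite bin_ffact (leq_trans _ (ffact_geq _ _)) // leq_exp2r; last by lia.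
  by rewrite /a; lia.
have sub := exp_leq_sub n a d.
have nd : n ^ d = n * n ^ d.-1 by rewrite -expnS prednK //; lia.
have big : (K + 12 * (d * a)) * n ^ d.-1 <= n ^ d by rewrite nd leq_mul2r; lia.
move: gap ff sub big; clear -n.
move: ('C(n - t, d.+1) - _) 'C(n - t - 4, d) d`! (n ^ d) (n ^ d.-1) ((n - a) ^ d).
move=> gap b f x y z le1 le2 le3 le4.
have := leq_mul (leqnn (3 * f)) le1; nia.
Qed.

(** The deletion of [U] removes at most [m * c * #|V| ^ (r - 2)] edges, which the
    constant [K] absorbs; what is left has too many edges for
    [card_path_free] and for [card_star_free]. *)
Lemma exists_path_avoiding (r l c m : nat) :
    2 < r -> 0 < l ->
  exists K, forall (V : finType) (E : {set {set V}}),
    (forall e, e \in E -> #|e| = r) ->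
    (forall v, #|[set e in E | v \in e]| <= c * #|V| ^ (r - 2)) ->
    7 * #|V| ^ r.-1 + K * #|V| ^ (r - 2) < 3 * (r.-1)`! * #|E| ->
  forall U : {set V}, #|U| <= m ->
    (exists f : vertex (linear_path r l) -> V, embeds (avoiding E U) f) /\
    (exists f : vertex (linear_star r l) -> V, embeds (avoiding E U) f).
Proof.
move=> r2 l0; have [C pathC] := card_path_free c r2 l0.
pose s := ((r - 1) * (l * r)) ^ 2; pose f := 3 * (r.-1)`!.
exists (f * (m * c) + (C + f * s)) => V E Er deg_E large U U_le.
have le_E : #|E| <= #|avoiding E U| + m * c * #|V| ^ (r - 2).
  apply: leq_trans (card_avoiding U deg_E) _.
  by rewrite leq_add2l mulnA !leq_mul2r U_le !orbT.
have Er_U e : e \in avoiding E U -> #|e| = r by rewrite inE => /andP[/Er].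
have le_f := leq_mul (leqnn f) le_E.
have large_U : 7 * #|V| ^ r.-1 + (C + f * s) * #|V| ^ (r - 2) < f * #|avoiding E U|.
  by move: large le_f; rewrite -/f; clear; lia.
have embeds_dec F : ~ ~ (exists g : vertex F -> V, embeds (avoiding E U) g) ->
    exists g : vertex F -> V, embeds (avoiding E U) g.
  by move=> not_no; have [//|/not_no] := containsP (Hypergraph (avoiding E U)) F.
split; apply: embeds_dec => no_F.
  have deg_U v : #|[set e in avoiding E U | v \in e]| <= c * #|V| ^ (r - 2).
    apply: leq_trans (deg_E v); apply/subset_leq_card/subsetP => e.
    by rewrite !inE => /andP[/andP[-> _] ->].
  have := pathC V _ Er_U deg_U no_F; rewrite -/f.
  by move: large_U; clear; lia.
have := leq_mul (leqnn f) (card_star_free r2 Er_U no_F); rewrite -/s.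
by move: large_U; clear; lia.
Qed.

(** The set [L] collects the possible centres of stars. By [noF], a deleted part
    [L'] of [L] can always be turned into stars once paths have been found in the
    rest, provided that [L'] has [k2] elements or that further stars can be found
    anywhere. So either [k2] vertices of [L] are deleted and the rest contains no
    [k1] disjoint paths, or [L] is too small and the rest has few edges. *)
Lemma turan_upper_bound (r l k1 k2 : nat) :
    2 < r -> 2 < l -> 1 < k1 ->
  exists n0, forall n, n0 <= n ->
  turan r n [:: disjoint_union (copies k1 (linear_path r l)) (copies k2 (linear_star r l))]
    <= 'C(n, r) - 'C(n - k2, r) + turan r (n - k2) [:: copies k1 (linear_path r l)].
Proof.
set P := linear_path r l; set S := linear_star r l => r2 l2 k1_gt1.
have r1 : 1 < r by apply: ltnW.
have l0 : 0 < l by apply: leq_trans l2.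
pose m := k1 * #|vertex P|; pose M := m + k2 * #|vertex S| + k2.
pose c := M + l * r.
have [K embK] := exists_path_avoiding c M r2 l0.
have [n0 budget] := budget_asymptotic k2 K r2.
exists (n0 + k2 + 2 * k1) => n n_ge.
apply/bigmax_leqP => E /andP[/forall_inP unifE freeE].
have Er e : e \in E -> #|e| = r by move/unifE/eqP.
have cardI : #|'I_n| = n by rewrite card_ord.
have spanP : spanned P by apply: spanned_path.
have spanS : spanned S by apply: spanned_star.
pose L := [set v | c * n ^ (r - 2) < #|[set e in E | v \in e]|].
have noF (L' : {set 'I_n}) (f : vertex (copies k1 P) -> 'I_n) :
    L' \subset L -> #|L'| <= k2 ->
    (k2 <= #|L'| \/ forall U : {set 'I_n}, #|U| <= M ->
       exists f : vertex S -> 'I_n, embeds (avoiding E U) f) ->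
    embeds (avoiding E L') f -> False.
  move=> /subsetP sL L'_le k_or /(embeds_avoid (spanned_copies spanP))[f_emb f_notin].
  pose U0 := [set f x | x in setT].
  have [||v /sL|g g_emb] := @embeds_stars _ r l k2 m E L' U0 r1 l0 Er L'_le _ _ _ k_or.
  - apply: leq_trans (leq_imset_card _ _) _.
    by rewrite cardsT card_prod card_ord.
  - apply/pred0Pn => -[y /andP[/= yL /imsetP[x _ eq_y]]].
    by rewrite eq_y (negPf (f_notin x)) in yL.
  - by rewrite inE cardI.
  have [g_embE g_notin] := embeds_avoid (spanned_copies spanS) g_emb.
  have [x y|fg fg_emb] := union_embeds f_emb g_embE.
    by apply: contraNneq (g_notin y) => <-; apply: imset_f.
  by move: freeE; rewrite /free /= andbT => /containsP; apply; exists fg.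
have split_E (L' : {set 'I_n}) : #|E| <= 'C(n, r) - 'C(n - #|L'|, r) + #|avoiding E L'|.
  have := card_hitting r L'; rewrite cardI => <-.
  rewrite -(cardsID (avoiding E L') E) addnC leq_add //.
    by apply/subset_leq_card/subsetP => e; rewrite !inE negb_and => /andP[/orP[/negPf->|->]//] /Er ->; rewrite eqxx.
  by rewrite subset_leq_card ?subsetIr.
have [k2_le|k2_gt] := leqP k2 #|L|.
  have [L' sL cardL'] := exists_subset_card k2_le.
  have := split_E L'; rewrite cardL' => /leq_trans -> //; rewrite leq_add2l.
  apply: (@card_leq_turan _ r (n - k2) (~: L')).
  - by have := cardsC L'; rewrite cardI cardL' => /(canRL (addKn _)).
  - move=> e; rewrite inE => /andP[/Er er dis_e]; split=> //.
    by rewrite subsets_disjoint setCK.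
  rewrite /free /= andbT; apply/containsP => -[f /noF]; apply=> //; first by rewrite cardL'.
  by left; rewrite cardL'.
have few : 3 * (r.-1)`! * #|avoiding E L| <= 7 * n ^ r.-1 + K * n ^ (r - 2).
  rewrite leqNgt; apply/negP => large.
  have E'r e : e \in avoiding E L -> #|e| = r by rewrite inE => /andP[/Er].
  have E'deg v : #|[set e in avoiding E L | v \in e]| <= c * #|'I_n| ^ (r - 2).
    rewrite cardI; have [vL|] := boolP (v \in L).
      rewrite (_ : [set _ in _ | _] = set0) ?cards0 //; apply/setP => e; rewrite !inE.
      by apply/negP => /andP[/andP[_ dis_e] /(disjointFr dis_e)]; rewrite vL.
    rewrite inE -leqNgt; apply: leq_trans; apply/subset_leq_card/subsetP => e.
    by rewrite !inE => /andP[/andP[-> _] ->].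
  have emb := embK _ _ E'r E'deg; rewrite cardI in emb.
  have [|i U _ U_le|f f_emb] := @greedy_embeddings _ (avoiding E L) P k1 set0 (fun=> set0).
  - by move=> i j _; rewrite -setI_eq0 setI0.
  - have [|[f f_emb] _] := emb large U.
      by rewrite (leq_trans U_le) // /M -addnA leq_addr.
    have [f_embE f_notin] := embeds_avoid spanP f_emb.
    exists f; split=> // x; rewrite ?inE //.
    by rewrite (negPf (f_notin x)).
  apply: noF f_emb => //; first exact: ltnW.
  right=> U U_le; have [_ [g g_emb]] := emb large U U_le.
  exists g; apply: embeds_sub g_emb; apply/subsetP => e.
  by rewrite !inE => /andP[/andP[-> _] ->].
apply: leq_trans (split_E L) _.
have E'_le : #|avoiding E L| <= 'C(n - #|L|, r) - 'C(n - #|L| - 4, r).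
  have f_gt0 : 0 < 3 * (r.-1)`! by rewrite muln_gt0 fact_gt0.
  rewrite -(leq_pmul2l f_gt0); apply: leq_trans few _; apply: budget; last exact: ltnW.
  by apply: leq_trans n_ge; rewrite -addnA leq_addr.
have lower : 'C(n - k2, r) - 'C(n - k2 - (2 * k1 - 1), r) <= turan r (n - k2) [:: copies k1 P].
  by apply: turan_copies_path_lower => //; [apply: ltnW | move: n_ge; clear; lia].
(* Four more vertices than [L] are still no more than [k2 + (2 * k1 - 1)], as
   [#|L| < k2] and [1 < k1]. *)
have le4 : 'C(n - k2 - (2 * k1 - 1), r) <= 'C(n - #|L| - 4, r).
  by apply: leq_bin2l; move: k2_gt k1_gt1; clear; lia.
have le3 : 'C(n - #|L| - 4, r) <= 'C(n - #|L|, r) by apply: leq_bin2l; apply: leq_subr.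
have le2 : 'C(n - #|L|, r) <= 'C(n, r) by apply: leq_bin2l; apply: leq_subr.
have le1 : 'C(n - k2, r) <= 'C(n, r) by apply: leq_bin2l; apply: leq_subr.
move: E'_le lower le4 le3 le2 le1; clear; lia.
Qed.

Theorem theorem1p4 (r l k1 k2 : nat)
    (hr : 3 <= r) (hl : 4 <= l) (hk1 : 2 <= k1) (hk2 : 0 <= k2) :
  exists n0 : nat, forall n : nat, n0 <= n ->
    let P := linear_path r l in
    let S := linear_star r l in
    let F := disjoint_union (copies k1 P) (copies k2 S) in
    turan r n [:: F]
      <= 'C(n, r) - 'C(n - k2, r) + turan r (n - k2) [:: copies k1 P]
    /\
    'C(n, r) - 'C(n - k1 - k2 + 1, r) + turan r (n - k1 - k2 + 1) [:: P; S]
      <= turan r n [:: F].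
Proof.
have [n0 upper] := turan_upper_bound k2 hr (ltnW hl) hk1.
exists (n0 + k1 + k2) => n n_ge P S F; split.
  by apply: upper; apply: leq_trans n_ge; rewrite -addnA leq_addr.
have le_n : k1 + k2 <= n by apply: leq_trans n_ge; rewrite -addnA leq_addl.
have -> : n - k1 - k2 + 1 = n - (k1 + k2 - 1) by move: le_n hk1; clear; lia.
by apply: turan_lower_bound => //; [apply: leq_trans hl | apply: ltnW].
Qed.
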